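(* Let $(\mathcal{M},g)$ be a closed surface, i.e. a compact connected oriented two-dimensional smooth Riemannian manifold without boundary, with area form $\mu$. Let $(\psi,\omega,\gamma,p)=(0,0,\gamma_0,p_0)$ be a harmonic Euler flow on $\mathcal{M}$: a (time-independent) harmonic covector field $\gamma_0$ on $\mathcal{M}$ together with a Bernoulli pressure $p_0$, solving the Euler equations in Hodge–Helmholtz form (given in the context). Then this flow is at most linearly unstable in the $L^2$ norm, in the following sense. Let $\widetilde v^\flat(t)=\star d\widetilde\psi(t)+\widetilde\gamma(t)$, $t\in[0,\infty)$, be any smooth perturbation, with $\widetilde\psi(t)$ a function and $\widetilde\gamma(t)$ a harmonic covector field on $\mathcal{M}$, which together with a smooth function $\widetilde p(t)$ satisfies the linearization of the Euler equations at this flow, $$\star d\widetilde\psi_t+\widetilde\gamma_t+\widetilde\omega\,\star\gamma_0+d\widetilde p=0,\qquad -\delta d\widetilde\psi=\widetilde\omega,\qquad t\ge 0.$$ Then there exist constants $A,B\ge 0$, independent of $t$ (but possibly depending on the perturbation), such that $$\|\widetilde v^\flat(t)\|_{L^2}\le A+Bt\qquad\text{for all } t\ge 0.$$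
   Context: On the oriented Riemannian surface $(\mathcal{M},g)$ with area form $\mu$, let $\star$ be the Hodge star, with $\star f=f\mu$ and $\star\mu=1$ for functions $f$, and $\star\star\alpha=-\alpha$, $\alpha\wedge\star\beta=(\alpha,\beta)\mu$ for covector fields (1-forms) $\alpha,\beta$, where $(\cdot,\cdot)$ is the pointwise inner product induced by $g$. The codifferential is $\delta=-\star d\star$. The Hodge inner product of covector fields is $\langle\alpha,\beta\rangle=\int_{\mathcal{M}}(\alpha,\beta)\,\mu$, and $\|\alpha\|_{L^2}=\langle\alpha,\alpha\rangle^{1/2}$. A covector field $\gamma$ is harmonic if $d\gamma=0$ and $\delta\gamma=0$. A subscript $t$ denotes the time derivative. The incompressible Euler equations on $\mathcal{M}$ for a velocity field $v$ with dual covector field $v^\flat$, in rotational form, are $$v^\flat_t+\omega\,\star v^\flat+dp=F^\flat,\qquad \delta v^\flat=0,\qquad \omega=\star dv^\flat,$$ where $\omega$ is the vorticity function, $p=p_s+\tfrac12 v^\flat(v)$ is the Bernoulli pressure ($p_s$ being the static pressure), and $F$ is a given external force. By the Hodge decomposition, an incompressible covector field is written as $v^\flat=\star d\psi+\gamma$ with $\psi$ a stream function and $\gamma$ harmonic, which gives the Hodge–Helmholtz form $$\star d\psi_t+\gamma_t+\omega\,(-d\psi+\star\gamma)+dp=F^\flat,\qquad -\delta d\psi=\omega.$$ The linearization at $(0,0,\gamma_0,p_0)$ is obtained by inserting $\psi=\varepsilon\widetilde\psi+O(\varepsilon^2)$, $\gamma=\gamma_0+\varepsilon\widetilde\gamma+O(\varepsilon^2)$,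 $p=p_0+\varepsilon\widetilde p+O(\varepsilon^2)$ with $F$ unperturbed and keeping terms of order $\varepsilon$. *)

(* Defs.v *)
From HB Require Import structures.
From mathcomp Require Import all_boot all_order all_algebra.
From mathcomp Require Import all_classical all_reals all_analysis.
From mathcomp Require Import ring.

Set Implicit Arguments.
Unset Strict Implicit.
Unset Printing Implicit Defensive.

Import Order.TTheory GRing.Theory Num.Theory.
Import numFieldNormedType.Exports.

Local Open Scope classical_set_scope.
Local Open Scope ring_scope.

Section Smoothness.
Context {R : realType} {V : normedModType R}.

Definition iter_derive (vs : seq V) (f : V -> R) : V -> R :=
  foldr (fun v g => 'D_v g) f vs.

(* C^oo on U; meant for U open. *)
Definition smooth_on (U : set V) (f : V -> R) : Prop :=
  forall (vs : seq V) (x : V), U x ->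
    {for x, continuous (iter_derive vs f)} /\
    (forall v, derivable (iter_derive vs f) x v).

(* C^oo on an arbitrary set A: locally the restriction of a smooth function
   defined on an open set. *)
Definition smooth_within (A : set V) (f : V -> R) : Prop :=
  forall x, A x -> exists U (g : V -> R),
    [/\ open U, U x, smooth_on U g & {in U `&` A, f =1 g}].

End Smoothness.

Section Plane.
Context {R : realType}.

Definition axis (k : 'I_2) : R * R := if k == 0 then (1, 0) else (0, 1).

Definition coordinate (k : 'I_2) (x : R * R) : R := if k == 0 then x.1 else x.2.

Definition partial (k : 'I_2) (f : R * R -> R) : R * R -> R := 'D_(axis k) f.

(* The matrix of a |-> (- a_1, a_0) acting on row vectors on the right. *)
Definition quarter_turn : 'M[R]_2 :=
  \matrix_(i, j) (if (i == 0) && (j == 1) then 1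
                  else if (i == 1) && (j == 0) then -1 else 0).

(* Derivative at t of a function on [0, +oo[; one-sided at t = 0. *)
Definition time_derive (f : R -> R) (t : R) : R :=
  lim ((fun h => h^-1 * (f (t + h) - f t)) @ within [set h | 0 <= t + h] 0^').

End Plane.

(* A surface is given by an oriented smooth atlas: chart i is the homeomorphism
   chart_map i from the open set dom i onto an open subset of the plane, with
   inverse param i (values outside dom i, resp. chart_map i @` dom i, are
   irrelevant). The chart chart_at q is one whose domain contains q. *)
Record orientedSurface (R : realType) := OrientedSurface {
  points :> ptopologicalType;
  surface_hausdorff : hausdorff_space points;
  surface_second_countable : @second_countable points;
  chart : Type;
  chart_at : points -> chart;
  dom : chart -> set points;
  chart_map : chart -> points -> R * R;
  param : chart -> R * R -> points;
  dom_chart_at : forall q, dom (chart_at q) q;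
  dom_open : forall i, open (dom i);
  range_open : forall i, open (chart_map i @` dom i);
  chart_map_continuous : forall i q, dom i q ->
    {for q, continuous (chart_map i)};
  param_continuous : forall i x, (chart_map i @` dom i) x ->
    {for x, continuous (param i)};
  chart_mapK : forall i q, dom i q -> param i (chart_map i q) = q;
  transition_smooth : forall i j k,
    smooth_on (chart_map i @` (dom i `&` dom j))
      (fun x => coordinate k (chart_map j (param i x)));
  transition_oriented : forall i j q, dom i q -> dom j q ->
    0 < \det (\matrix_(a, b)
          partial a (fun x => coordinate b (chart_map j (param i x)))
            (chart_map i q))
}.

Definition chart_range {R : realType} (S : orientedSurface R) (i : chart S) :
  set (R * R) := chart_map i @` dom i.

(* Entry (a, b) is the derivative of the b-th coordinate of chart j along the
   a-th coordinate of chart i. *)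
Definition jac {R : realType} (S : orientedSurface R) (i j : chart S) (q : S) :
  'M[R]_2 := \matrix_(a, b)
    partial a (fun x => coordinate b (chart_map j (param i x))) (chart_map i q).

(* metric i q is the Gram matrix of g at q in the coordinates of chart i. *)
Record riemannianSurface (R : realType) := RiemannianSurface {
  surface :> orientedSurface R;
  metric : chart surface -> surface -> 'M[R]_2;
  metric_smooth : forall (i : chart surface) a b,
    smooth_on (chart_range i) (fun x => metric i (param i x) a b);
  metric_sym : forall (i : chart surface) (q : surface), dom i q ->
    (metric i q)^T = metric i q;
  metric_pos : forall (i : chart surface) (q : surface), dom i q ->
    forall v : 'rV[R]_2, v != 0 -> 0 < (v *m metric i q *m v^T) 0 0;
  metric_change : forall (i j : chart surface) (q : surface),
    dom i q -> dom j q ->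
    metric i q = jac i j q *m metric j q *m (jac i j q)^T
}.

Section Calculus.
Context {R : realType} (S : riemannianSurface R).

(* Differential forms are families of chart expressions: for a covector field
   alpha, alpha i q is the row of its components at q in the coordinates of
   chart i (meaningful for q in dom i); for a 2-form beta, beta i q is its
   coefficient with respect to dx_0 /\ dx_1. *)
Definition form1 := chart S -> S -> 'rV[R]_2.
Definition form2 := chart S -> S -> R.

Definition covector_law (alpha : form1) : Prop :=
  forall i j q, dom i q -> dom j q -> alpha i q = alpha j q *m (jac i j q)^T.

Definition covector_field (alpha : form1) : Prop :=
  covector_law alpha /\
  forall i k, smooth_on (chart_range i) (fun x => alpha i (param i x) 0 k).

Definition d0 (f : S -> R) : form1 :=
  fun i q => \row_k partial k (f \o param i) (chart_map i q).

Definition d1 (alpha : form1) : form2 :=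
  fun i q => partial 0 (fun x => alpha i (param i x) 0 1) (chart_map i q)
           - partial 1 (fun x => alpha i (param i x) 0 0) (chart_map i q).

Definition area_form : form2 := fun i q => Num.sqrt (\det (metric i q)).

Definition inner_in (i : chart S) (q : S) (a b : 'rV[R]_2) : R :=
  (a *m invmx (metric i q) *m b^T) 0 0.

(* Independent of the chart (inner_chart below). *)
Definition inner (alpha beta : form1) (q : S) : R :=
  inner_in (chart_at q) q (alpha (chart_at q) q) (beta (chart_at q) q).

Definition wedge (alpha beta : form1) : form2 :=
  fun i q => alpha i q 0 0 * beta i q 0 1 - alpha i q 0 1 * beta i q 0 0.

(* The star with alpha /\ star beta = (alpha, beta) mu (wedge_star below). *)
Definition star1 (alpha : form1) : form1 :=
  fun i q => area_form i q *: (alpha i q *m invmx (metric i q) *m quarter_turn).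

(* The function star beta, read in each chart, so that star mu = 1. *)
Definition star2 (beta : form2) : chart S -> S -> R :=
  fun i q => beta i q / area_form i q.

Definition codiff (alpha : form1) : chart S -> S -> R :=
  fun i q => - star2 (d1 (star1 alpha)) i q.

Definition harmonic_field (gamma : form1) : Prop :=
  forall i q, dom i q -> d1 gamma i q = 0 /\ codiff gamma i q = 0.

Definition halfline_range (i : chart S) : set (R * (R * R)) :=
  [set tx | 0 <= tx.1 /\ chart_range i tx.2].

(* Smoothness on [0, +oo[ x S; values at negative times are irrelevant. *)
Definition smooth_evolution (f : R -> S -> R) : Prop :=
  forall i : chart S,
    smooth_within (halfline_range i) (fun tx => f tx.1 (param i tx.2)).

Definition covector_evolution (alpha : R -> form1) : Prop :=
  (forall t, 0 <= t -> covector_law (alpha t)) /\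
  forall i k, smooth_within (halfline_range i)
    (fun tx => alpha tx.1 i (param i tx.2) 0 k).

Definition dt0 (f : R -> S -> R) (t : R) : S -> R :=
  fun q => time_derive (fun s => f s q) t.

Definition dt1 (alpha : R -> form1) (t : R) : form1 :=
  fun i q => \row_k time_derive (fun s => alpha s i q 0 k) t.

(* Euler equations in Hodge-Helmholtz form; F stands for the covector field
   dual to the force. *)
Definition euler (psi omega : R -> S -> R) (gamma : R -> form1)
    (p : R -> S -> R) (F : R -> form1) : Prop :=
  forall t, 0 <= t -> forall i q, dom i q ->
    star1 (d0 (dt0 psi t)) i q + dt1 gamma t i q
      + omega t q *: (- d0 (psi t) i q + star1 (gamma t) i q)
      + d0 (p t) i q = F t i q /\
    - codiff (d0 (psi t)) i q = omega t q.

Definition harmonic_euler_flow (gamma0 : form1) (p0 : R -> S -> R)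
    (F : R -> form1) : Prop :=
  [/\ covector_field gamma0, harmonic_field gamma0, smooth_evolution p0,
      covector_evolution F
    & euler (fun _ _ => 0) (fun _ _ => 0) (fun _ => gamma0) p0 F].

Definition linearized_euler (gamma0 : form1) (psi omega : R -> S -> R)
    (gamma : R -> form1) (p : R -> S -> R) : Prop :=
  forall t, 0 <= t -> forall i q, dom i q ->
    star1 (d0 (dt0 psi t)) i q + dt1 gamma t i q
      + omega t q *: star1 gamma0 i q + d0 (p t) i q = 0 /\
    - codiff (d0 (psi t)) i q = omega t q.

Definition velocity (psi : R -> S -> R) (gamma : R -> form1) (t : R) : form1 :=
  fun i q => star1 (d0 (psi t)) i q + gamma t i q.

Definition borel := g_sigma_algebraType (@open S).

(* mu is the Borel measure A |-> \int_A area_form; it is determined by its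
   values on the Borel subsets of chart domains. *)
Definition area_measure (mu : {measure set borel -> \bar R}) : Prop :=
  forall (i : chart S) (A : set borel), measurable A -> A `<=` dom i ->
    mu A = (\int[(@lebesgue_measure R \x @lebesgue_measure R)%E]_(x in
              chart_map i @` A) (area_form i (param i x))%:E)%E.

Definition L2norm (mu : {measure set borel -> \bar R}) (alpha : form1) : R :=
  Num.sqrt (Rintegral mu [set: borel] (inner alpha alpha)).

End Calculus.

Arguments form1 {R} S.
Arguments borel {R} S.

Section Consistency.
Context {R : realType} (S : riemannianSurface R).
Implicit Types (i j : chart S) (q : S) (alpha beta : form1 S).

Lemma det2 (A : 'M[R]_2) : \det A = A 0 0 * A 1 1 - A 0 1 * A 1 0.
Proof.
rewrite (expand_det_row _ 0) !big_ord_recl big_ord0 /cofactor !det_mx11 !mxE.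
have [l0 l1 o0] : [/\ lift 0 0 = 1 :> 'I_2, lift 1 0 = 0 :> 'I_2
  & ord0 = 0 :> 'I_2] by split => //; exact/val_inj.
by rewrite !o0 l0 l1 /= expr0 expr1; ring.
Qed.

Lemma metric_det_gt0 i q : dom i q -> 0 < \det (metric i q).
Proof.
move=> qi; have gs := metric_sym qi; have gp := metric_pos qi.
have g10 : metric i q 1 0 = metric i q 0 1 by rewrite -{1}gs mxE.
have quad (v : 'rV[R]_2) : (v *m metric i q *m v^T) 0 0 =
    v 0 0 ^+ 2 * metric i q 0 0 + 2 * v 0 0 * v 0 1 * metric i q 0 1
    + v 0 1 ^+ 2 * metric i q 1 1.
  rewrite !mxE !big_ord_recl big_ord0 !mxE !big_ord_recl !big_ord0 /=.
  rewrite (_ : lift ord0 ord0 = 1 :> 'I_2); last exact/val_inj.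
  by rewrite (_ : ord0 = 0 :> 'I_2)// g10; ring.
have a_gt0 : 0 < metric i q 0 0.
  have /gp : (\row_k (k == 0)%:R : 'rV[R]_2) != 0.
    by apply/eqP => /rowP/(_ 0)/eqP; rewrite !mxE oner_eq0.
  by rewrite quad !mxE /= expr1n expr0n !mulr0 !mul0r mul1r !addr0.
have /gp : (\row_k (if k == 0 then - metric i q 0 1 else metric i q 0 0)
    : 'rV[R]_2) != 0.
  by apply/eqP => /rowP/(_ 1)/eqP; rewrite !mxE /= gt_eqF.
rewrite quad !mxE /= det2 g10.
set a := metric i q 0 0; set b := metric i q 0 1; set c := metric i q 1 1.
rewrite (_ : _ + _ = a * (a * c - b * b)); last by ring.
by rewrite pmulr_rgt0.
Qed.

Lemma metric_unit i q : dom i q -> metric i q \in unitmx.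
Proof. by move=> qi; rewrite unitmxE unitfE gt_eqF// metric_det_gt0. Qed.

Lemma inner_chart alpha beta i q :
  covector_law alpha -> covector_law beta -> dom i q ->
  inner alpha beta q = inner_in i q (alpha i q) (beta i q).
Proof.
move=> ha hb qi; rewrite /inner; set j := chart_at q.
have qj : dom j q := dom_chart_at q.
rewrite /inner_in (ha _ _ _ qi qj) (hb _ _ _ qi qj) (metric_change qi qj).
set J := jac i j q; set g := metric j q.
have J_unit : J \in unitmx.
  rewrite unitmxE unitfE gt_eqF//.
  exact: (transition_oriented qi qj).
have g_unit : g \in unitmx := metric_unit qj.
have Jt_unit : J^T \in unitmx by rewrite unitmx_tr.
have -> : invmx (J *m g *m J^T) = invmx J^T *m invmx g *m invmx J.
  have h_unit : J *m g *m J^T \in unitmx.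
    by rewrite !unitmx_mul J_unit g_unit Jt_unit.
  apply: (can_inj (mulKmx h_unit)); rewrite mulmxV//.
  by rewrite -!mulmxA (mulKVmx Jt_unit) (mulKVmx g_unit) mulmxV.
by rewrite trmx_mul trmxK -!mulmxA (mulKVmx Jt_unit) (mulKmx J_unit).
Qed.

Lemma wedge_star alpha beta i q : dom i q ->
  wedge alpha (star1 beta) i q =
  inner_in i q (alpha i q) (beta i q) * area_form i q.
Proof.
move=> qi; rewrite /wedge /star1 /inner_in.
have gVs : (invmx (metric i q))^T = invmx (metric i q).
  by rewrite trmx_inv metric_sym.
rewrite -[in RHS]mulmxA -[X in _ *m (X *m _)]gVs -trmx_mul.
set u := beta i q *m _; rewrite !mxE !big_ord_recl !big_ord0 !mxE /=.
rewrite (_ : lift ord0 ord0 = 1 :> 'I_2); last exact/val_inj.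
by rewrite (_ : ord0 = 0 :> 'I_2)//; ring.
Qed.

Lemma star1K alpha i q : dom i q -> star1 (star1 alpha) i q = - alpha i q.
Proof.
move=> qi; have d_gt0 := metric_det_gt0 qi; have g_unit := metric_unit qi.
have gVs : (invmx (metric i q))^T = invmx (metric i q).
  by rewrite trmx_inv metric_sym.
rewrite /star1 -!scalemxAl scalerA -expr2 sqr_sqrtr ?ltW//.
have turnE (A : 'M[R]_2) :
    A^T = A -> A *m quarter_turn *m A *m quarter_turn = - (\det A)%:M.
  move=> As; have A10 : A 1 0 = A 0 1 by rewrite -{1}As mxE.
  have lift1 : lift ord0 ord0 = 1 :> 'I_2 by exact/val_inj.
  have ord00 : ord0 = 0 :> 'I_2 by [].
  rewrite det2; apply/matrixP => a b.
  rewrite !mxE !big_ord_recl !big_ord0 !mxE !big_ord_recl !big_ord0 !mxE.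
  rewrite !big_ord_recl !big_ord0 !mxE /= lift1 ord00 /=.
  have two (k : 'I_2) : k = 0 \/ k = 1.
    by case: k => -[|[|//]] ?; [left|right]; exact/val_inj.
  by have [-> | ->] := two a; have [-> | ->] := two b; rewrite /= ?A10; ring.
rewrite -!mulmxA [X in _ *m X](_ : _ = - (\det (metric i q))^-1%:M).
  by rewrite mulmxN mul_mx_scalar scalerN scalerA divff ?gt_eqF// scale1r.
by rewrite !mulmxA turnE// det_inv.
Qed.

End Consistency.

(* Main.v *)
Require Import Defs.
From HB Require Import structures.
From mathcomp Require Import all_boot all_order all_algebra.
From mathcomp Require Import all_classical all_reals all_analysis.
From mathcomp Require Import measurable_realfun ring lra.

Import Order.TTheory GRing.Theory Num.Theory.
Import numFieldNormedType.Exports.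

Local Open Scope classical_set_scope.
Local Open Scope ring_scope.

(** Write [v = star d psi + gamma] for the perturbation velocity and
[omega = star dv] for its vorticity; the linearized equation reads
[v_t + omega star gamma0 + dp = 0]. Two facts give the theorem.

The enstrophy, the integral of [omega ^ 2], is constant. The exterior derivative
of the equation is [omega_t = - (d omega, gamma0)], as [star gamma0] is closed
([dt_omega]). Hence the enstrophy has derivative [- \int (d (omega ^ 2), gamma0)],
which vanishes because [gamma0] is coclosed ([is_derive_enstrophy]).

The energy, the integral of [(v, v)], has derivative
[- 2 \int omega (star gamma0, v)], the pressure term [\int (dp, v)] being zero
because [v] is coclosed ([is_derive_energy]). As [star gamma0] is bounded and the
enstrophy is constant, this is at most a constant times the square root of the
energy, up to a harmless additive constant, so the L^2 norm of [v] is Lipschitz in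
time ([L2norm_velocity_linear]). Estimating [v] itself, and not [star d psi] and
[gamma] separately, avoids the Poincare inequality and the orthogonality of the
Hodge decomposition.

Everything is done at positive times, where the flow is smooth in the ordinary
sense; the Lipschitz bound from time 1 in both directions covers all positive times,
and time 0 contributes its own norm to the constant.

The analytic core is integration by parts: [\int (df, alpha) = 0] for [alpha]
coclosed ([stokes]). A C^1 partition of unity made of squares of truncated quadratics
reduces it to one coordinate square, where [(df, alpha) mu = d (f star alpha)] is a
divergence of functions vanishing on the boundary. This uses the chain rule, so that
differentials do not depend on the chart ([covector_law_d0]), Schwarz's theorem
([derive_comm]), and the description of the area measure as the image of a weighted
Lebesgue measure ([integral_transfer]). *)

(** * Functions of class C^k on a normed space *)
Section CkCalculus.
Context {R : realType} {V : normedModType R}.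
Implicit Types (U : set V) (f g : V -> R) (x v : V).

(** Derivatives are taken in all directions rather than along a basis, so that
the class makes sense in the plane and in space-time alike, and induction on
[n] gives its closure properties. *)
Fixpoint Ck n (U : set V) (f : V -> R) : Prop :=
  (forall x, U x -> {for x, continuous f}) /\
  if n is m.+1 then
    (forall x v, U x -> derivable f x v) /\ (forall v, Ck m U ('D_v f))
  else True.

Lemma Ck_continuous n U f x : Ck n U f -> U x -> {for x, continuous f}.
Proof. by case: n => [|n] /= [+ _] Ux; apply. Qed.

Lemma Ck_derivable n U f x v : Ck n.+1 U f -> U x -> derivable f x v.
Proof. by move=> [_ [+ _]]; apply. Qed.

Lemma Ck_derive n U f v : Ck n.+1 U f -> Ck n U ('D_v f).
Proof. by move=> [_ [_ Df]]; exact: Df. Qed.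

Lemma CkW n U f : Ck n.+1 U f -> Ck n U f.
Proof.
elim: n f => [|n IH] f [fc [fd fD]]; first by [].
by split => //; split => // v; exact/IH/fD.
Qed.

Lemma Ck_subset n U U' f : U' `<=` U -> Ck n U f -> Ck n U' f.
Proof.
move=> U'U; elim: n f => [|n IH] f /= [fc fd].
  by split => // x /U'U; exact: fc.
split; first by move=> x /U'U; exact: fc.
by split => [x v /U'U|v]; [exact: fd.1|exact/IH/fd.2].
Qed.

(** Openness of [U] makes equality on [U] an equality near each point, which is
what derivatives see. *)
Lemma Ck_eq n U f g : open U -> {in U, f =1 g} -> Ck n U f -> Ck n U g.
Proof.
move=> oU; elim: n f g => [|n IH] f g fg fk.
all: have near_fg x : U x -> {near x, f =1 g}.
1,3: by move=> Ux; near=> y; apply: fg; rewrite inE; near: y; exact: open_nbhs_nbhs.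
all: have gc x : U x -> {for x, continuous g}.
1,3: move=> Ux; have fgx := near_fg x Ux; have := Ck_continuous _ _ _ _ fk Ux.
1,2: rewrite /prop_for /continuous_at (nbhs_singleton fgx).
1,2: by apply: cvg_trans; apply: near_eq_cvg; exact: fgx.
  by split.
split => //; split.
  move=> x v Ux; apply: near_eq_derivable (near_fg x Ux) _.
  exact: Ck_derivable fk Ux.
move=> v; apply: IH (Ck_derive _ _ _ v fk) => x /[!inE] Ux.
exact/near_eq_derive/near_fg.
Unshelve. all: by end_near. Qed.

Lemma smooth_on_Ck n U f : smooth_on U f -> Ck n U f.
Proof.
elim: n f => [|n IH] f sf; first by split => // x Ux; exact: (sf [::] x Ux).1.
split; first by move=> x Ux; exact: (sf [::] x Ux).1.
split; first by move=> x v Ux; exact: (sf [::] x Ux).2.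
move=> v; apply: IH => vs x Ux.
by have := sf (rcons vs v) x Ux; rewrite /iter_derive foldr_rcons.
Qed.

Lemma Ck_cst n U (c : R) : Ck n U (fun=> c).
Proof.
elim: n c => [|n IH] c; first by split => // x _; exact: cst_continuous.
split; first by move=> x _; exact: cst_continuous.
split=> [x v _|v]; first exact: derivable_cst.
rewrite (_ : 'D_v _ = fun=> 0); first exact: IH.
by apply/funext => x; rewrite derive_cst.
Qed.

Lemma CkD n U f g : open U -> Ck n U f -> Ck n U g ->
  Ck n U (fun x => f x + g x).
Proof.
move=> oU; elim: n f g => [|n IH] f g Cf Cg.
all: have fgc x : U x -> {for x, continuous (fun x => f x + g x)}.
1,3: by move=> Ux; apply: cvgD; [exact: (Ck_continuous _ _ _ _ Cf)|
       exact: (Ck_continuous _ _ _ _ Cg)].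
  by split.
split => //; split => [x v Ux|v].
  by apply: derivableD; [exact: Ck_derivable Cf _|exact: Ck_derivable Cg _].
apply: Ck_eq (IH _ _ (Ck_derive _ _ _ v Cf) (Ck_derive _ _ _ v Cg)) => //.
move=> x /[!inE] Ux; rewrite -deriveD//.
  exact: Ck_derivable Cf _.
exact: Ck_derivable Cg _.
Qed.

Lemma CkM n U f g : open U -> Ck n U f -> Ck n U g ->
  Ck n U (fun x => f x * g x).
Proof.
move=> oU; elim: n f g => [|n IH] f g Cf Cg.
all: have fgc x : U x -> {for x, continuous (fun x => f x * g x)}.
1,3: by move=> Ux; apply: cvgM; [exact: (Ck_continuous _ _ _ _ Cf)|
       exact: (Ck_continuous _ _ _ _ Cg)].
  by split.
split => //; split => [x v Ux|v].
  by apply: derivableM; [exact: Ck_derivable Cf _|exact: Ck_derivable Cg _].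
have C1 := IH _ _ (CkW _ _ _ Cf) (Ck_derive _ _ _ v Cg).
have C2 := IH _ _ (CkW _ _ _ Cg) (Ck_derive _ _ _ v Cf).
apply: Ck_eq (CkD _ _ _ _ oU C1 C2) => //.
move=> x /[!inE] Ux; rewrite [RHS]deriveM//.
  exact: Ck_derivable Cf _.
exact: Ck_derivable Cg _.
Qed.

Lemma CkN n U f : open U -> Ck n U f -> Ck n U (fun x => - f x).
Proof.
move=> oU Cf; apply: Ck_eq (CkM _ _ _ _ oU (Ck_cst n U (-1)) Cf) => //.
by move=> x _; rewrite mulN1r.
Qed.

Lemma CkB n U f g : open U -> Ck n U f -> Ck n U g ->
  Ck n U (fun x => f x - g x).
Proof. by move=> oU Cf Cg; apply: CkD => //; exact: CkN. Qed.

Lemma Ck_sum n U (I : Type) (r : seq I) (F : I -> V -> R) : open U ->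
  (forall i, Ck n U (F i)) -> Ck n U (fun x => \sum_(i <- r) F i x).
Proof.
move=> oU CF; elim: r => [|i r IH].
  apply: Ck_eq (Ck_cst n U 0) => //.
  by move=> x _; rewrite big_nil.
apply: Ck_eq (CkD _ _ _ _ oU (CF i) IH) => //.
by move=> x _; rewrite big_cons.
Qed.

(** A directional derivative is the derivative at 0 of a function of one real
variable, so the one-variable chain rule applies. *)
Lemma is_derive_comp1 (h : R -> R) (h' : R) f x v : derivable f x v ->
  is_derive (f x) (1 : R) h h' -> is_derive x v (h \o f) (h' * 'D_v f x).
Proof.
move=> fd hd.
have H : is_derive (0 : R) (1 : R) (h \o (fun s => f (s *: v + x))) (h' * 'D_v f x).
  apply: is_derive1_comp; first by rewrite scale0r add0r.
  split; first exact: (derivable1P f x v).1.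
  rewrite /derive; set a := (fun _ => _); set b := (X in _ = lim (X @ _)).
  rewrite (_ : a = b)//; apply/funext => s; rewrite /a /b /=.
  by rewrite addr0 scale0r add0r [_%:A]mulr1.
have [Hd He] := H; split; first exact: (derivable1P (h \o f) x v).2.
rewrite -He /derive; set a := (fun _ => _); set b := (X in _ = lim (X @ _)).
rewrite (_ : a = b)//; apply/funext => s; rewrite /a /b /=.
by rewrite addr0 scale0r add0r [_%:A]mulr1.
Qed.

Lemma CkV n U f : open U -> (forall x, U x -> f x != 0) ->
  Ck n U f -> Ck n U (fun x => (f x)^-1).
Proof.
move=> oU f0; elim: n => [|n IH] Cf.
all: have fc x : U x -> {for x, continuous (fun x => (f x)^-1)}.
1,3: by move=> Ux; apply: cvgV; [exact: f0|exact: (Ck_continuous _ _ _ _ Cf)].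
  by split.
split => //; split => [x v Ux|v].
  by apply: derivableV; [exact: f0|exact: Ck_derivable Cf _].
have C1 := IH (CkW _ _ _ Cf).
have C2 := CkM _ _ _ _ oU (CkM _ _ _ _ oU C1 C1) (Ck_derive _ _ _ v Cf).
apply: Ck_eq (CkN _ _ _ oU C2) => //.
move=> x /[!inE] Ux; rewrite deriveV ?f0//; last exact: Ck_derivable Cf _.
by rewrite scaleNr -invfM.
Qed.

Lemma Ck_sqrt n U f : open U -> (forall x, U x -> 0 < f x) ->
  Ck n U f -> Ck n U (fun x => Num.sqrt (f x)).
Proof.
move=> oU f0; elim: n => [|n IH] Cf.
all: have fc x : U x -> {for x, continuous (fun x => Num.sqrt (f x))}.
1,3: move=> Ux; apply: continuous_comp; [exact: (Ck_continuous _ _ _ _ Cf)|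
       exact: sqrt_continuous].
  by split.
have fd x v : U x ->
    is_derive x v (fun x => Num.sqrt (f x)) ((2 * Num.sqrt (f x))^-1 * 'D_v f x).
  move=> Ux; apply: (is_derive_comp1 Num.sqrt); first exact: Ck_derivable Cf Ux.
  exact/is_derive1_sqrt/f0.
split => //; split => [x v Ux|v]; first by have [] := fd x v Ux.
have C1 := IH (CkW _ _ _ Cf).
have C2 : Ck n U (fun x => (2 * Num.sqrt (f x))^-1).
  apply: CkV => //; last by apply: CkM => //; exact: Ck_cst.
  by move=> x Ux; rewrite mulf_neq0// gt_eqF// sqrtr_gt0 f0.
apply: Ck_eq (CkM _ _ _ _ oU C2 (Ck_derive _ _ _ v Cf)) => //.
by move=> x /[!inE] Ux; have [_ ->] := fd x v Ux.
Qed.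

(** The squared positive part is the source of all cutoff functions below: it
is C^1, and one continuous derivative is all that integration by parts needs. *)
Lemma is_derive_pos_sqr (y : R) :
  is_derive y (1 : R) (fun s : R => Num.max 0 s ^+ 2) (2 * Num.max 0 y).
Proof.
have [y0|y0|->] := ltgtP y 0.
- apply: (@near_eq_is_derive _ _ _ (cst 0)).
    near=> s; rewrite (max_idPl _) ?expr0n//=.
    by near: s; apply: filterS (lt_nbhsl y0) => ? /ltW.
  by rewrite mulr0; exact: is_derive_cst.
- apply: (@near_eq_is_derive R R R (fun s : R => s ^+ 2)).
    near=> s; rewrite (max_idPr _)//=.
    by near: s; apply: filterS (lt_nbhsr y0) => ? /ltW.
  have := @is_deriveX _ _ id 2 y 1 1 (is_derive_id y 1).
  by move=> H; apply: is_derive_eq; rewrite /= expr1 scaler1.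
rewrite mulr0.
have H : (fun h : R => h^-1 *: (((fun s : R => Num.max 0 s ^+ 2) \o shift (0 : R))
    (h *: (1 : R)) - Num.max (0 : R) 0 ^+ 2)) @ 0^' --> (0 : R).
  rewrite (_ : (fun h => _) = (fun h => if 0 <= h then h else 0)).
    have h0 : (fun h : R => `|h|) @ 0^' --> (0 : R).
      have : (fun h : R => `|h|) @ 0^' --> `|0 : R|.
        by apply: cvg_within_filter; exact: norm_continuous.
      by rewrite normr0.
    apply: norm_cvg0; apply: squeeze_cvgr (cvg_cst 0) h0.
    near=> h; rewrite normr_ge0/=; case: ifP => // _; rewrite ?normr0//.
  apply/funext => h /=; rewrite maxxx expr0n/= subr0 addr0 [_%:A]mulr1.
  case: ifPn => [h0|]; last first.
    by rewrite -ltNge => /ltW h0; rewrite (max_idPl _)// expr0n/= scaler0.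
  rewrite (max_idPr h0) expr2 scalerA; have [->|h1] := eqVneq h 0; first by rewrite scaler0.
  by rewrite mulVf// scale1r.
split; first by apply/cvg_ex; exists 0.
exact: cvg_lim H.
Unshelve. all: by end_near. Qed.

Lemma C1_pos_sqr U f : open U -> Ck 1 U f ->
  Ck 1 U (fun x => Num.max 0 (f x) ^+ 2).
Proof.
move=> oU Cf.
have mc x : U x -> {for x, continuous (fun x => Num.max 0 (f x))}.
  move=> Ux; apply: continuous_max; first exact: cst_continuous.
  exact: Ck_continuous Cf Ux.
have fd x v : U x ->
    is_derive x v (fun x => Num.max 0 (f x) ^+ 2)
      (2 * Num.max 0 (f x) * 'D_v f x).
  move=> Ux; apply: (is_derive_comp1 (fun s => Num.max 0 s ^+ 2)).
    exact: Ck_derivable Cf Ux.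
  exact: is_derive_pos_sqr.
split.
  move=> x Ux; rewrite (_ : (fun x => _) =
    (fun x => Num.max 0 (f x)) \* (fun x => Num.max 0 (f x))).
    by move=> A; apply: continuousM; exact: mc.
  by apply/funext => y; rewrite /= expr2.
split => [x v Ux|v]; first by have [] := fd x v Ux.
have C0 : Ck 0 U (fun x => Num.max 0 (f x)) by split.
have C2 := CkM _ _ _ _ oU (Ck_cst 0 U 2) C0.
apply: Ck_eq (CkM _ _ _ _ oU C2 (Ck_derive _ _ _ v Cf)) => //.
by move=> x /[!inE] Ux; have [_ ->] := fd x v Ux.
Qed.

End CkCalculus.

(** * Affine substitutions, mean values and mixed derivatives *)
Section Affine.
Context {R : realType} {V W : normedModType R}.
Implicit Types (f : V -> R) (L : W -> V).

Lemma derive_affine f L w v y :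
  (forall h : R, L (h *: w + y) = h *: v + L y) ->
  'D_w (f \o L) y = 'D_v f (L y).
Proof.
move=> hL; rewrite /derive; set a := (fun _ => _); set b := (fun _ => _).
by rewrite (_ : a = b)//; apply/funext => h; rewrite /a /b /= hL.
Qed.

Lemma derivable_affine f L w v y :
  (forall h : R, L (h *: w + y) = h *: v + L y) ->
  derivable f (L y) v -> derivable (f \o L) y w.
Proof.
move=> hL; rewrite /derivable; set a := (fun _ => _); set b := (fun _ => _).
by rewrite (_ : a = b)//; apply/funext => h; rewrite /a /b /= hL.
Qed.

(** This covers restriction to a line, to a time slice [x |-> (t, x)], and the
lift of a function of space to space-time. *)
Lemma Ck_affine n (U : set V) f L (ell : W -> V) : continuous L ->
  (forall (h : R) w y, L (h *: w + y) = h *: ell w + L y) ->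
  Ck n U f -> Ck n (L @^-1` U) (f \o L).
Proof.
move=> Lc hL; elim: n f => [|n IH] f Cf.
all: have fc y : (L @^-1` U) y -> {for y, continuous (f \o L)}.
1,3: by move=> Uy; apply: continuous_comp; [exact: Lc|exact: Ck_continuous Cf _].
  by split.
split => //; split => [y w Uy|w].
  apply: (@derivable_affine _ _ _ (ell w)) => //; exact: Ck_derivable Cf _.
rewrite (_ : 'D_w _ = 'D_(ell w) f \o L); first exact/IH/Ck_derive.
by apply/funext => y; apply: derive_affine.
Qed.

End Affine.

Section MeanValue.
Context {R : realType} {V : normedModType R}.
Implicit Types (f : V -> R) (x u v : V).

Lemma is_derive_line f x u (s : R) : derivable f (x + s *: u) u ->
  is_derive s 1 (fun s : R => f (x + s *: u)) ('D_u f (x + s *: u)).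
Proof.
move=> fd; have hL (h : R) : (fun s : R => x + s *: u) (h *: (1 : R) + s) =
    h *: u + (fun s : R => x + s *: u) s.
  by rewrite /= [h *: 1]mulr1 scalerDl addrCA.
split; first exact: derivable_affine hL fd.
exact: derive_affine hL.
Qed.

Lemma mean_value_line f x u (s : R) : 0 <= s ->
  (forall r : R, 0 <= r <= s -> derivable f (x + r *: u) u) ->
  exists2 r : R, 0 <= r <= s &
    f (x + s *: u) - f x = s * 'D_u f (x + r *: u).
Proof.
move=> s0 fd.
have := @MVT_segment _ (fun r : R => f (x + r *: u))
  (fun r => 'D_u f (x + r *: u)) 0 s s0.
case.
- move=> r; rewrite in_itv/= => /andP[r0 rs]; apply: is_derive_line.
  by apply: fd; rewrite (ltW r0) (ltW rs).
- apply: derivable_within_continuous => r; rewrite in_itv/= => rs.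
  by have [] := is_derive_line f x u r (fd r rs).
- move=> r; rewrite in_itv/= => rs; rewrite scale0r addr0 subr0 => ->.
  by exists r => //; rewrite mulrC.
Qed.

(** The mean value theorem is applied along [u] to the increment of [f] in the
direction [v], then along [v]. Since the left-hand side is symmetric in the
two directions, it computes both mixed derivatives. *)
Lemma second_difference f x u v (s t : R) : 0 <= s -> 0 <= t ->
  (forall a b : R, 0 <= a <= s -> 0 <= b <= t ->
    derivable f (x + a *: u + b *: v) u /\
    derivable ('D_u f) (x + a *: u + b *: v) v) ->
  exists a b : R, [/\ 0 <= a <= s, 0 <= b <= t &
    f (x + s *: u + t *: v) - f (x + t *: v) - f (x + s *: u) + f x =
    s * t * 'D_v ('D_u f) (x + a *: u + b *: v)].
Proof.
move=> s0 t0 H.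
pose g y := f (y + t *: v) - f y.
have H0 (a : R) : 0 <= a <= s -> derivable f (x + a *: u) u.
  move=> has_; have t00 : 0 <= (0 : R) <= t by rewrite lexx.
  by have [] := H a 0 has_ t00; rewrite scale0r addr0.
have hL (y : V) (h : R) : (fun y => y + t *: v) (h *: u + y) =
    h *: u + (fun y => y + t *: v) y by rewrite /= addrA.
have gd (a : R) : 0 <= a <= s -> is_derive (x + a *: u) u g
    ('D_u f (x + a *: u + t *: v) - 'D_u f (x + a *: u)).
  move=> hs; have tt : 0 <= t <= t by rewrite lexx andbT.
  have [d1 _] := H a t hs tt.
  have d2 := H0 _ hs.
  have d3 : derivable (fun y => f (y + t *: v)) (x + a *: u) u.
    exact: derivable_affine (hL _) d1.
  split; first exact: derivableB.
  rewrite (deriveB d3 d2); congr (_ - _); exact: derive_affine (hL _).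
have [a as_] : exists2 a : R, 0 <= a <= s &
    g (x + s *: u) - g x = s * 'D_u g (x + a *: u).
  by apply: (mean_value_line g x u s s0) => r /gd[].
have [_ ->] := gd a as_ => E.
have [b bt Eb] : exists2 b : R, 0 <= b <= t &
    'D_u f (x + a *: u + t *: v) - 'D_u f (x + a *: u) =
    t * 'D_v ('D_u f) (x + a *: u + b *: v).
  by apply: (mean_value_line ('D_u f) (x + a *: u) v t t0) => r rt; have [] := H a r as_ rt.
exists a, b; split => //; rewrite -mulrA -Eb -E /g; ring.
Qed.

Lemma near_plane x u v (P : V -> Prop) : (\forall y \near x, P y) ->
  \forall s \near (0 : R)^'+, forall a b : R, 0 <= a <= s -> 0 <= b <= s ->
    P (x + a *: u + b *: v).
Proof.
move=> /nbhs_ballP[e /= e0 eP].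
pose M := `|u| + `|v| + 1.
have M0 : 0 < M by rewrite /M ltr_wpDl// addr_ge0.
near=> s => a b /andP[a0 as_] /andP[b0 bs]; apply: eP.
rewrite -ball_normE /= -addrA opprD addrA subrr add0r normrN.
rewrite (le_lt_trans (ler_normD _ _))// !normrZ !ger0_norm//.
have s0 : 0 < s by near: s; exact: nbhs_right_gt.
apply: (@le_lt_trans _ _ (s * `|u| + s * `|v|)).
  by rewrite lerD// ler_wpM2r.
apply: (@lt_trans _ _ (s * M)); first by rewrite /M -mulrDr ltr_pM2l// ltrDl.
rewrite -ltr_pdivlMr//; near: s; apply: nbhs_right_lt; exact: divr_gt0.
Unshelve. all: by end_near. Qed.

(** Schwarz's theorem: by [second_difference] the two mixed derivatives take a
common value at two points arbitrarily close to [x], and both are continuous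
at [x]. *)
Lemma derive_comm (U : set V) f x u v : open U -> Ck 2 U f -> U x ->
  'D_u ('D_v f) x = 'D_v ('D_u f) x.
Proof.
move=> oU Cf Ux.
have cuv : {for x, continuous ('D_u ('D_v f))}.
  exact: (Ck_continuous 0 U) (Ck_derive _ _ _ _ (Ck_derive _ _ _ _ Cf)) Ux.
have cvu : {for x, continuous ('D_v ('D_u f))}.
  exact: (Ck_continuous 0 U) (Ck_derive _ _ _ _ (Ck_derive _ _ _ _ Cf)) Ux.
have nU : \forall y \near x, U y by exact: open_nbhs_nbhs.
apply/eqP; rewrite -subr_eq0 -normr_le0; apply/ler_addgt0Pr => e e0.
rewrite add0r; have e20 : 0 < e / 2 by rewrite divr_gt0.
have nuv : \forall y \near x, `|'D_u ('D_v f) x - 'D_u ('D_v f) y| < e / 2.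
  by move/cvgrPdist_lt : cuv; apply.
have nvu : \forall y \near x, `|'D_v ('D_u f) x - 'D_v ('D_u f) y| < e / 2.
  by move/cvgrPdist_lt : cvu; apply.
have nall : \forall y \near x, [/\ U y,
    `|'D_u ('D_v f) x - 'D_u ('D_v f) y| < e / 2 &
    `|'D_v ('D_u f) x - 'D_v ('D_u f) y| < e / 2].
  by apply: filterS3 nU nuv nvu => y.
have [s s0 Hs] : exists2 s : R, 0 < s & forall a b : R,
    0 <= a <= s -> 0 <= b <= s -> [/\ U (x + a *: u + b *: v),
    `|'D_u ('D_v f) x - 'D_u ('D_v f) (x + a *: u + b *: v)| < e / 2 &
    `|'D_v ('D_u f) x - 'D_v ('D_u f) (x + a *: u + b *: v)| < e / 2].
  have := near_plane x u v _ nall => H.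
  near (0 : R)^'+ => s; exists s; first by near: s; exact: nbhs_right_gt.
  by near: s.
have [a [b [sa sb E1]]] := second_difference f x u v s s (ltW s0) (ltW s0)
  (fun a b sa sb => let: And3 Uab _ _ := Hs a b sa sb in
    conj (Ck_derivable _ _ _ _ u Cf Uab)
     (Ck_derivable _ _ _ _ v (Ck_derive _ _ _ u Cf) Uab)).
have Hswap (c d : R) : x + d *: v + c *: u = x + c *: u + d *: v by rewrite addrAC.
have [d [c [sd sc E2]]] : exists d c : R, [/\ 0 <= d <= s, 0 <= c <= s &
    f (x + s *: v + s *: u) - f (x + s *: u) - f (x + s *: v) + f x =
    s * s * 'D_u ('D_v f) (x + d *: v + c *: u)].
  apply: second_difference; [exact: ltW|exact: ltW|].
  move=> d c sd sc; rewrite Hswap; have [Uab _ _] := Hs c d sc sd; split.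
    exact: Ck_derivable Cf Uab.
  exact: Ck_derivable (Ck_derive _ _ _ v Cf) Uab.
have E : 'D_u ('D_v f) (x + d *: v + c *: u) =
    'D_v ('D_u f) (x + a *: u + b *: v).
  have ss0 : s * s != 0 by rewrite mulf_neq0// gt_eqF.
  apply: (mulfI ss0); rewrite -[RHS]E1 -[LHS]E2.
  by rewrite (Hswap s s); congr (_ + _); exact: addrAC.
have [_ _ H1] := Hs a b sa sb; have [_ H2 _] := Hs c d sc sd.
rewrite -Hswap E in H2.
have tri (A B C : R) : `|A - C| < e / 2 -> `|B - C| < e / 2 -> `|A - B| <= e.
  move=> h1 h2; rewrite (_ : A - B = (A - C) - (B - C)); last by ring.
  rewrite [leRHS]splitr; apply: le_trans (ler_normB _ _) _.
  by apply: lerD; exact: ltW.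
exact: tri H2 H1.
Unshelve. all: by end_near. Qed.

End MeanValue.

(** * The chain rule in the plane *)
Section ChainRule.
Context {R : realType}.
Implicit Types (f : R * R -> R).

Lemma mean_value_between (g dg : R -> R) (p q : R) :
  (forall r, `|r - p| <= `|q - p| -> is_derive r 1 g (dg r)) ->
  exists2 r, `|r - p| <= `|q - p| & g q - g p = (q - p) * dg r.
Proof.
move=> gd; have [pq|/ltW qp] := leP p q.
- have H r : r \in `[p, q]%R -> `|r - p| <= `|q - p|.
    rewrite in_itv/= => /andP[pr rq].
    by rewrite !ger0_norm ?subr_ge0// lerD2r.
  have [||r rpq ->] := @MVT_segment _ g dg p q pq.
  + by move=> r rpq; apply/gd/H/subset_itv_oo_cc.
  + by apply: derivable_within_continuous => r /H/gd[].
  + by exists r; [exact: H|rewrite mulrC].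
- have H r : r \in `[q, p]%R -> `|r - p| <= `|q - p|.
    rewrite in_itv/= => /andP[qr rp].
    by rewrite !ler0_norm ?subr_le0// lerN2 lerD2r.
  have [||r rpq E] := @MVT_segment _ g dg q p qp.
  + by move=> r rpq; apply/gd/H/subset_itv_oo_cc.
  + by apply: derivable_within_continuous => r /H/gd[].
  + by exists r; [exact: H|rewrite -opprB E -mulrN opprB mulrC].
Qed.

Lemma is_derive_slice1 f (s y : R) : derivable f (s, y) (1, 0) ->
  is_derive s 1 (fun s => f (s, y)) ('D_(1, 0) f (s, y)).
Proof.
have hL (h : R) : (fun s : R => (s, y)) (h *: (1 : R) + s) =
    h *: ((1, 0) : R * R) + (fun s : R => (s, y)) s.
  by congr pair; rewrite /= scaler0 add0r.
by move=> fd; split; [exact: derivable_affine hL fd|exact: derive_affine hL].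
Qed.

Lemma is_derive_slice2 f (x s : R) : derivable f (x, s) (0, 1) ->
  is_derive s 1 (fun s => f (x, s)) ('D_(0, 1) f (x, s)).
Proof.
have hL (h : R) : (fun s : R => (x, s)) (h *: (1 : R) + s) =
    h *: ((0, 1) : R * R) + (fun s : R => (x, s)) s.
  by congr pair; rewrite /= scaler0 add0r.
by move=> fd; split; [exact: derivable_affine hL fd|exact: derive_affine hL].
Qed.

(** The increment is taken along the horizontal side, then along the vertical
side, of the rectangle with opposite corners [p] and [q]; the ball, being a
square, contains this path. *)
Lemma increment_plane (e : R) f (p q : R * R) : Ck 1 (ball p e) f ->
  ball p e q -> exists r1 r2 : R * R,
  [/\ `|r1.1 - p.1| <= `|q.1 - p.1|, `|r1.2 - p.2| <= `|q.2 - p.2|,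
      `|r2.1 - p.1| <= `|q.1 - p.1|, `|r2.2 - p.2| <= `|q.2 - p.2| &
  f q - f p = (q.1 - p.1) * 'D_(1, 0) f r1 + (q.2 - p.2) * 'D_(0, 1) f r2].
Proof.
case: p => p1 p2; case: q => q1 q2 Cf [].
rewrite -!ball_normE /= => q1e q2e.
have be (x y : R) : `|x - p1| <= `|q1 - p1| -> `|y - p2| <= `|q2 - p2| ->
    ball (p1, p2) e (x, y).
  move=> x1 y1; split; rewrite /= -ball_normE /= distrC.
    by rewrite (le_lt_trans x1)// distrC.
  by rewrite (le_lt_trans y1)// distrC.
have [r r1 E1] := mean_value_between (fun s => f (s, q2))
  (fun s => 'D_(1, 0) f (s, q2)) p1 q1 (fun r hr =>
   is_derive_slice1 f r q2 (Ck_derivable _ _ _ _ _ Cf (be r q2 hr (lexx _)))).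
have pp : `|p1 - p1| <= `|q1 - p1| by rewrite subrr normr0.
have [s s1 E2] := mean_value_between (fun s => f (p1, s))
  (fun s => 'D_(0, 1) f (p1, s)) p2 q2 (fun r hr =>
   is_derive_slice2 f p1 r (Ck_derivable _ _ _ _ _ Cf (be p1 r pp hr))).
exists (r, q2), (p1, s); split => //=.
by rewrite -E1 -E2 addrA subrK.
Qed.

(** The increment of [f] along the curve [h |-> T (x + h v)] is written by
[increment_plane] with partial derivatives taken at points that tend to [T x];
their continuity gives the limit of the difference quotient. *)
Lemma is_derive_chain {W : normedModType R} (U : set (R * R)) f
    (T : W -> R * R) (x v : W) (a b : R) :
  open U -> Ck 1 U f -> U (T x) ->
  is_derive x v (fun y => (T y).1) a -> is_derive x v (fun y => (T y).2) b ->
  is_derive x v (f \o T) (a * 'D_(1, 0) f (T x) + b * 'D_(0, 1) f (T x)).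
Proof.
move=> oU Cf UT [d1 <-] [d2 <-].
have [e /= e0 eU] : nbhs_ball (T x) U.
  by apply/nbhs_ballP; exact: open_nbhs_nbhs.
have Cfe := Ck_subset _ _ _ _ eU Cf.
(* Outside the ball the intermediate points are arbitrary; only points q
   close to T x matter. *)
have /choice[r Hr] : forall q, exists r : (R * R) * (R * R), ball (T x) e q ->
  [/\ `|r.1.1 - (T x).1| <= `|q.1 - (T x).1|,
      `|r.1.2 - (T x).2| <= `|q.2 - (T x).2|,
      `|r.2.1 - (T x).1| <= `|q.1 - (T x).1|,
      `|r.2.2 - (T x).2| <= `|q.2 - (T x).2| &
  f q - f (T x) = (q.1 - (T x).1) * 'D_(1, 0) f r.1
                + (q.2 - (T x).2) * 'D_(0, 1) f r.2].
  move=> q; have [qe|nqe] := pselect (ball (T x) e q); last by exists (q, q).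
  by have [r1 [r2 H]] := increment_plane _ _ _ _ Cfe qe; exists (r1, r2).
have shift_cvg (g : W -> R) : derivable g x v ->
    (fun h : R => g (h *: v + x)) @ 0^' --> g x.
  move=> gd.
  suff /continuous_withinNx : {for 0, continuous (fun h : R => g (h *: v + x))}.
    by rewrite scale0r add0r.
  exact/differentiable_continuous/derivable1_diffP/(derivable1P _ _ _).1.
have c1 := shift_cvg _ d1; have c2 := shift_cvg _ d2.
have near_ball (e' : R) : 0 < e' ->
    \forall h \near 0^', `|(T (h *: v + x)).1 - (T x).1| < e' /\
       `|(T (h *: v + x)).2 - (T x).2| < e'.
  move=> e'0.
  move/cvgrPdist_lt : c1 => /(_ _ e'0) n1; move/cvgrPdist_lt : c2 => /(_ _ e'0) n2.
  by apply: filterS2 n1 n2 => h; rewrite !(distrC (_ (T x))).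
have Tball : \forall h \near 0^', ball (T x) e (T (h *: v + x)).
  apply: filterS (near_ball _ e0) => h [h1 h2].
  by split; rewrite /= -ball_normE /= distrC.
have r1 : (fun h : R => (r (T (h *: v + x))).1) @ 0^' --> T x.
  apply/cvgrPdist_lt => e' e'0; apply: filterS2 Tball (near_ball _ e'0) => h hb [h1 h2].
  have [H1 H2 _ _ _] := Hr _ hb.
  by rewrite distrC prod_normE gt_max (le_lt_trans H1 h1) (le_lt_trans H2 h2).
have r2 : (fun h : R => (r (T (h *: v + x))).2) @ 0^' --> T x.
  apply/cvgrPdist_lt => e' e'0; apply: filterS2 Tball (near_ball _ e'0) => h hb [h1 h2].
  have [_ _ H1 H2 _] := Hr _ hb.
  by rewrite distrC prod_normE gt_max (le_lt_trans H1 h1) (le_lt_trans H2 h2).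
have D1 : {for T x, continuous ('D_(1, 0) f)}.
  exact: Ck_continuous (Ck_derive _ _ _ _ Cf) UT.
have D2 : {for T x, continuous ('D_(0, 1) f)}.
  exact: Ck_continuous (Ck_derive _ _ _ _ Cf) UT.
have key : (fun h => h^-1 *: (((f \o T) \o shift x) (h *: v) - (f \o T) x)) @ 0^' -->
    'D_v (fun y => (T y).1) x * 'D_(1, 0) f (T x)
    + 'D_v (fun y => (T y).2) x * 'D_(0, 1) f (T x).
  refine (cvg_trans _ (cvgD (cvgM d1 (cvg_comp _ _ r1 D1))
    (cvgM d2 (cvg_comp _ _ r2 D2)))).
  apply: near_eq_cvg; apply: filterS Tball => h hb.
  have [_ _ _ _ E] := Hr _ hb.
  rewrite /= E scalerDr.
  by congr (_ + _); exact: esym (scalerAl _ _ _).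
split; first by apply/cvg_ex; eexists; exact: key.
exact: cvg_lim key.
Qed.

End ChainRule.

(** * Transfer of integrals along a parametrization with density *)
Section Transfer.
Context d1 d2 (X : measurableType d1) (Y : measurableType d2) (R : realType).
Variables (lam : {measure set X -> \bar R}) (mu : {measure set Y -> \bar R}).
Variables (D : set X) (E : set Y) (phi : X -> Y) (rho : X -> R).
Hypotheses (mD : measurable D) (mE : measurable E).
Hypotheses (phiE : forall x, D x -> E (phi x)) (mphi : measurable_fun D phi).
Hypotheses (rho0 : forall x, D x -> 0 <= rho x) (mrho : measurable_fun D rho).
Hypothesis mu_rho : forall A, measurable A -> A `<=` E ->
  mu A = (\int[lam]_(x in D `&` phi @^-1` A) (rho x)%:E)%E.

Import HBNNSimple.

Let m_comp (f : Y -> R) : measurable_fun E f ->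
  measurable_fun D (fun x => f (phi x)).
Proof.
move=> mf; apply: (measurable_comp mE) => //.
by move=> _ [x Dx <-]; exact: phiE.
Qed.

(** Both sides are continuous along increasing sequences and linear, so the
hypothesis on [mu], which is the case of an indicator function, extends to
simple functions and then to all nonnegative measurable functions. *)
Lemma ge0_integral_transfer (f : Y -> R) : measurable_fun E f ->
  (forall y, E y -> 0 <= f y) ->
  (\int[mu]_(y in E) (f y)%:E = \int[lam]_(x in D) (f (phi x) * rho x)%:E)%E.
Proof.
move=> mf f0; have mEf : measurable_fun E (EFin \o f) by exact/measurable_EFinP.
have Ef0 y : E y -> (0 <= (EFin \o f) y)%E by move=> Ey; rewrite lee_fin f0.
pose h := nnsfun_approx mE mEf.
have mh n : measurable_fun E (h n) by exact: measurable_funTS.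
have -> : (\int[mu]_(y in E) (f y)%:E =
    limn (fun n => \int[mu]_(y in E) (h n y)%:E))%E.
  rewrite -monotone_convergence//.
  - apply: eq_integral => y /[!inE] Ey; apply/esym/cvg_lim => //.
    exact: cvg_nnsfun_approx.
  - by move=> n; exact/measurable_EFinP.
  - by move=> n y _; rewrite lee_fin.
  - by move=> y _ m n mn; rewrite lee_fin; exact/lefP/nd_nnsfun_approx.
have -> : (\int[lam]_(x in D) (f (phi x) * rho x)%:E =
    limn (fun n => \int[lam]_(x in D) (h n (phi x) * rho x)%:E))%E.
  rewrite -monotone_convergence//.
  - apply: eq_integral => x /[!inE] Dx; apply/esym/cvg_lim => //.
    rewrite EFinM; under eq_fun do rewrite EFinM.
    apply: cvgeZr => //; exact: (cvg_nnsfun_approx mE mEf Ef0 (phiE _ Dx)).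
  - move=> n; apply/measurable_EFinP; apply: measurable_funM => //.
    exact: m_comp.
  - by move=> n x Dx; rewrite lee_fin mulr_ge0// rho0.
  - move=> x Dx m n mn; rewrite lee_fin ler_wpM2r ?rho0//.
    exact/lefP/nd_nnsfun_approx.
congr (limn _); apply/funext => n.
have mhr r : measurable (h n @^-1` [set r]) by [].
have mir r : measurable_fun D (fun x => \1_(h n @^-1` [set r]) (phi x) : R).
  by apply: m_comp; exact: measurable_funTS.
transitivity (\sum_(r \in range (h n))
    \int[mu]_(y in E) (r * \1_(h n @^-1` [set r]) y)%:E)%E.
  rewrite -ge0_integral_fsum//; last 2 first.
  - by move=> r; exact/measurable_EFinP/measurable_funTS/measurable_funM.
  - by move=> r y _; rewrite nnfun_muleindic_ge0.
  by apply: eq_integral => y _; rewrite fsumEFin// -fimfunE.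
transitivity (\sum_(r \in range (h n)) \int[lam]_(x in D)
    (r * \1_(h n @^-1` [set r]) (phi x) * rho x)%:E)%E; last first.
  rewrite -ge0_integral_fsum//; last 2 first.
  - move=> r; apply/measurable_EFinP/measurable_funM => //.
    by apply: measurable_funM.
  - move=> r x Dx; rewrite EFinM mule_ge0 ?lee_fin ?rho0//.
    have := @nnfun_muleindic_ge0 _ _ _ (h n) r (phi x).
    by rewrite lee_fin.
  apply: eq_integral => x _.
  rewrite fsumEFin//; congr EFin; rewrite [in RHS](fimfunE (h n)).
  by rewrite -mulr_fsuml.
apply: eq_fsbigr => r /[!inE] -[y _ hr].
have r0 : 0 <= r by rewrite -hr.
under eq_integral do rewrite EFinM.
rewrite ge0_integralZl//; last first.
  exact/measurable_EFinP/measurable_funTS.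
under [RHS]eq_integral do rewrite -mulrA EFinM.
rewrite ge0_integralZl//; last 2 first.
- by apply/measurable_EFinP/measurable_funM.
- by move=> x Dx; rewrite lee_fin mulr_ge0// rho0.
congr (_ * _)%E; rewrite integral_indic// mu_rho; last 2 first.
- exact: measurableI.
- exact: subIsetr.
rewrite integral_mkcondr; apply: eq_integral => x /[!inE] Dx.
rewrite patchE EFinM indicE.
have [H|H] := pselect (h n (phi x) = r); first rewrite !mem_set ?mul1e//.
  by split => //; exact: phiE.
by rewrite !memNset ?mul0e// => -[].
Qed.

(** The density is nonnegative, hence taking positive and negative parts commutes
with multiplication by it. *)
Lemma integral_transfer (f : Y -> R) : measurable_fun E f ->
  (\int[mu]_(y in E) (f y)%:E = \int[lam]_(x in D) (f (phi x) * rho x)%:E)%E.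
Proof.
move=> mf; rewrite integralE [RHS]integralE; congr (_ - _)%E.
- rewrite (_ : (fun y => (f y)%:E)^\+%E = (fun y => (Num.max (f y) 0)%:E)); last first.
    by apply/funext => y; rewrite funeposE EFin_max.
  rewrite ge0_integral_transfer//; last 2 first.
  - exact: measurable_maxr.
  - by move=> y _; rewrite le_max lexx orbT.
  apply: eq_integral => x /[!inE] Dx; rewrite funeposE -EFin_max.
  by rewrite -{2}(mul0r (rho x)) maxr_pMl ?rho0.
- rewrite (_ : (fun y => (f y)%:E)^\-%E = (fun y => (Num.max (- f y) 0)%:E)); last first.
    by apply/funext => y; rewrite funenegE EFin_max.
  rewrite ge0_integral_transfer//; last 2 first.
  - by apply: measurable_maxr => //; exact: measurableT_comp.
  - by move=> y _; rewrite le_max lexx orbT.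
  apply: eq_integral => x /[!inE] Dx; rewrite funenegE -EFinN -EFin_max.
  by rewrite -mulNr -{2}(mul0r (rho x)) maxr_pMl ?rho0.
Qed.

End Transfer.

(** * Integration over boxes of the plane *)
(** Bounded open intervals generate the Borel sets of the line. *)
Lemma measurable_fun_open d (T : measurableType d) (R : realType) (D : set T)
    (f : T -> R) : (forall B : set R, open B -> measurable (D `&` f @^-1` B)) ->
  measurable_fun D f.
Proof.
move=> Hf; apply: (measurability _ (RGenOpens.measurableE R)).
by move=> _ [_ [a [b ->] <-]]; apply: Hf; exact: interval_open.
Qed.

Lemma continuous_slice1 (X Y Z : topologicalType) (g : X * Y -> Z) x y :
  {for (x, y), continuous g} -> {for x, continuous (fun x => g (x, y))}.
Proof.
move=> gc; have pc : {for x, continuous (fun x => (x, y))}.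
  apply: cvg_pair; first exact: cvg_id.
  exact: cvg_cst.
exact: (continuous_comp pc gc).
Qed.

Lemma continuous_slice2 (X Y Z : topologicalType) (g : X * Y -> Z) x y :
  {for (x, y), continuous g} -> {for y, continuous (fun y => g (x, y))}.
Proof.
move=> gc; have pc : {for y, continuous (fun y => (x, y))}.
  apply: cvg_pair; first exact: cvg_cst.
  exact: cvg_id.
exact: (continuous_comp pc gc).
Qed.

Section Plane.
Context {R : realType}.
Notation leb := (@lebesgue_measure R).
Notation leb2 := (leb \x leb)%E.
Notation mplane := (measurableTypeR R * measurableTypeR R)%type.

(** An open set is the union of the rectangles with rational vertices that it
contains, and there are countably many of those. *)
Lemma open_measurable_plane (U : set (R * R)) : open U ->
  measurable (U : set mplane).
Proof.
move=> oU.
pose rect (k : (rat * rat) * (rat * rat)) : set mplane :=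
  `]ratr k.1.1, ratr k.1.2[%classic `*` `]ratr k.2.1, ratr k.2.2[%classic.
have -> : U = \bigcup_(k in [set k | rect k `<=` U]) rect k.
  apply/seteqP; split => [[x y] Ux|x [k kU]]; last exact: kU.
  have [e /= e0 eU] : nbhs_ball (x, y) U.
    by apply/nbhs_ballP; exact: open_nbhs_nbhs.
  have sub (z : R) : z - e < z by rewrite ltrBlDr ltrDl.
  have add (z : R) : z < z + e by rewrite ltrDl.
  have [a] := rat_in_itvoo (sub x); rewrite in_itv/= => /andP[a1 a2].
  have [b] := rat_in_itvoo (add x); rewrite in_itv/= => /andP[b1 b2].
  have [c] := rat_in_itvoo (sub y); rewrite in_itv/= => /andP[c1 c2].
  have [d] := rat_in_itvoo (add y); rewrite in_itv/= => /andP[d1 d2].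
  exists ((a, b), (c, d)); last by split; rewrite /= in_itv/= ?a2 ?c2.
  move=> [x' y'] [] /=; rewrite !in_itv/= => /andP[ax bx] /andP[cy dy].
  apply: eU; split; rewrite -ball_normE /= ltr_distlC.
    by rewrite (lt_trans a1 ax) (lt_trans bx b2).
  by rewrite (lt_trans c1 cy) (lt_trans dy d2).
rewrite bigcup_mkcond; apply: countable_bigcupT_measurable => // k.
case: ifPn => // _; apply: measurableX; exact: measurable_itv.
Qed.

Lemma continuous_measurable_plane (U : set (R * R)) (f : R * R -> R) :
  open U -> (forall x, U x -> {for x, continuous f}) ->
  measurable_fun (U : set mplane) f.
Proof.
move=> oU fc; apply: measurable_fun_open => B oB.
apply: open_measurable_plane; rewrite openE => x [Ux Bx].
apply: filterI; first exact: open_nbhs_nbhs.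
by apply: (fc x Ux); exact: open_nbhs_nbhs.
Qed.

Definition box (a b : R * R) : set (R * R) :=
  `[a.1, b.1]%classic `*` `[a.2, b.2]%classic.

Lemma compact_box a b : compact (box a b).
Proof. by apply: compact_setX; exact: segment_compact. Qed.

Lemma measurable_box a b : measurable (box a b : set mplane).
Proof. by apply: measurableX; exact: measurable_itv. Qed.

Lemma leb_box a b : (leb2 (box a b) < +oo)%E.
Proof.
rewrite /box product_measure1E; [|exact: measurable_itv..].
have fin (x y : R) : leb `[x, y]%classic \is a fin_num.
  by rewrite lebesgue_measure_itv; case: ifP => _; rewrite -?EFinB.
by rewrite ltey_eq (fin_numM (fin _ _) (fin _ _)).
Qed.

Lemma integrable_box (U : set (R * R)) (f : R * R -> R) a b : open U ->
  box a b `<=` U -> (forall x, U x -> {for x, continuous f}) ->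
  leb2.-integrable (box a b) (EFin \o f).
Proof.
move=> oU KU fc.
apply: measurable_bounded_integrable.
- exact: measurable_box.
- exact: leb_box.
- exact: measurable_funS (open_measurable_plane _ oU) KU
    (continuous_measurable_plane _ _ oU fc).
have [K0|K0] := eqVneq (box a b) set0.
  by exists 0; split => // M _ x; rewrite K0.
have fK : {within box a b, continuous (fun x => `|f x|)}.
  apply: continuous_in_subspaceT => x /[!inE] /KU Ux.
  by apply: (continuous_comp (fc _ Ux)); exact: norm_continuous.
have K1 : box a b !=set0 by exact/set0P.
have [c _ cM] := compact_EVT_max K1 (compact_box a b) fK.
exists `|f c|; split => // M fM x /= Kx.
by apply: le_trans (cM x _) (ltW fM); rewrite inE.
Qed.

(** Fubini's theorem with inner integration in the first variable, where the
fundamental theorem of calculus leaves only the vanishing boundary values. *)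
Lemma integral_box_dx (U : set (R * R)) (f : R * R -> R) a b : open U ->
  Ck 1 U f -> box a b `<=` U -> a.1 < b.1 ->
  (forall y, f (a.1, y) = 0 /\ f (b.1, y) = 0) ->
  (\int[leb2]_(x in box a b) ('D_(1, 0) f x)%:E = 0)%E.
Proof.
move=> oU Cf KU ab f0.
have C0 := Ck_derive _ _ _ ((1, 0) : R * R) Cf.
have := integrable_box _ _ _ _ oU KU (fun x => Ck_continuous _ _ _ x C0).
move/(integrable_mkcond _ (measurable_box a b)) => If.
rewrite integral_mkcond -(integral21_prod_meas1 If).
apply: integral0_eq => y _; rewrite /fubini_G.
have [yab|yab] := pselect (a.2 <= y <= b.2); last first.
  apply: integral0_eq => x _; rewrite patchE memNset//.
  by move=> [_] /=; rewrite in_itv.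
rewrite (_ : (fun x => _) = (fun x => ('D_(1, 0) f (x, y))%:E) \_ `[a.1, b.1]).
  rewrite -integral_mkcond.
  have Ky x : x \in `[a.1, b.1] -> U (x, y).
    by rewrite in_itv/= => xab; apply: KU; split; rewrite /= in_itv.
  have cy (g : R * R -> R) x : {for (x, y), continuous g} ->
      {for x, continuous (fun x => g (x, y))}.
    by move=> gc; exact: continuous_slice1.
  have Fc : {within `[a.1, b.1], continuous (fun x => f (x, y))}.
    apply: continuous_in_subspaceT => x /[!inE]/= xab.
    by apply: cy; exact: Ck_continuous Cf (Ky _ xab).
  rewrite (@continuous_FTC2 _ _ (fun x => f (x, y)))//.
  - by have [-> ->] := f0 y; rewrite subee.
  - apply: continuous_in_subspaceT => x /[!inE]/= xab.
    by apply: (cy ('D_((1, 0) : R * R) f)); exact: Ck_continuous C0 (Ky _ xab).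
  - have [_ l r] := (continuous_within_itvP _ ab).1 Fc.
    split => // x xab.
    have Uxy := Ky x (subset_itv_oo_cc xab).
    by have [] := is_derive_slice1 f x y (Ck_derivable _ _ _ _ ((1, 0) : R * R) Cf Uxy).
  - move=> x xab; have Uxy := Ky x (subset_itv_oo_cc xab).
    rewrite derive1E.
    by have [_ ->] := is_derive_slice1 f x y (Ck_derivable _ _ _ _ ((1, 0) : R * R) Cf Uxy).
apply/funext => x; rewrite !patchE; congr (if _ then _ else _).
apply/idP/idP; rewrite !inE; first by case.
by move=> H; split => //=; rewrite in_itv.
Qed.

Lemma integral_box_dy (U : set (R * R)) (f : R * R -> R) a b : open U ->
  Ck 1 U f -> box a b `<=` U -> a.2 < b.2 ->
  (forall x, f (x, a.2) = 0 /\ f (x, b.2) = 0) ->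
  (\int[leb2]_(x in box a b) ('D_(0, 1) f x)%:E = 0)%E.
Proof.
move=> oU Cf KU ab f0.
have C0 := Ck_derive _ _ _ ((0, 1) : R * R) Cf.
have := integrable_box _ _ _ _ oU KU (fun x => Ck_continuous _ _ _ x C0).
move/(integrable_mkcond _ (measurable_box a b)) => If.
rewrite integral_mkcond -(integral12_prod_meas1 If).
apply: integral0_eq => x _; rewrite /fubini_F.
have [xab|xab] := pselect (a.1 <= x <= b.1); last first.
  apply: integral0_eq => y _; rewrite patchE memNset//.
  by move=> [] /=; rewrite in_itv.
rewrite (_ : (fun y => _) = (fun y => ('D_(0, 1) f (x, y))%:E) \_ `[a.2, b.2]).
  rewrite -integral_mkcond.
  have Ky y : y \in `[a.2, b.2] -> U (x, y).
    by rewrite in_itv/= => yab; apply: KU; split; rewrite /= in_itv.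
  have cy (g : R * R -> R) y : {for (x, y), continuous g} ->
      {for y, continuous (fun y => g (x, y))}.
    by move=> gc; exact: continuous_slice2.
  have Fc : {within `[a.2, b.2], continuous (fun y => f (x, y))}.
    apply: continuous_in_subspaceT => y /[!inE]/= yab.
    by apply: cy; exact: Ck_continuous Cf (Ky _ yab).
  rewrite (@continuous_FTC2 _ _ (fun y => f (x, y)))//.
  - by have [-> ->] := f0 x; rewrite subee.
  - apply: continuous_in_subspaceT => y /[!inE]/= yab.
    by apply: (cy ('D_((0, 1) : R * R) f)); exact: Ck_continuous C0 (Ky _ yab).
  - have [_ l r] := (continuous_within_itvP _ ab).1 Fc.
    split => // y yab.
    have Uxy := Ky y (subset_itv_oo_cc yab).
    by have [] := is_derive_slice2 f x y (Ck_derivable _ _ _ _ ((0, 1) : R * R) Cf Uxy).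
  - move=> y yab; have Uxy := Ky y (subset_itv_oo_cc yab).
    rewrite derive1E.
    by have [_ ->] := is_derive_slice2 f x y (Ck_derivable _ _ _ _ ((0, 1) : R * R) Cf Uxy).
apply/funext => y; rewrite !patchE; congr (if _ then _ else _).
apply/idP/idP; rewrite !inE; first by case.
by move=> H; split => //=; rewrite in_itv.
Qed.

End Plane.

(** * Regular families on space-time *)
(** The class is local; this is what turns the definition of smoothness on the
closed half-line of times into the usual one at positive times. *)
Lemma Ck_local {R : realType} {V : normedModType R} n (U : set V) (f : V -> R) :
  (forall x, U x -> exists U', [/\ open U', U' x & Ck n U' f]) -> Ck n U f.
Proof.
elim: n f => [|n IH] f H.
  by split => // x /H[U' [_ U'x Cf]]; exact: Ck_continuous Cf U'x.
split; first by move=> x /H[U' [_ U'x Cf]]; exact: Ck_continuous Cf U'x.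
split; first by move=> x v /H[U' [_ U'x Cf]]; exact: Ck_derivable Cf U'x.
move=> v; apply: IH => x /H[U' [oU' U'x Cf]].
by exists U'; split => //; exact: Ck_derive.
Qed.

(** At positive times the constraint [0 <= t + h] holds for all small [h], so the
one-sided definition reduces to the usual derivative. *)
Lemma time_deriveE {R : realType} (f : R -> R) t : 0 < t -> time_derive f t = 'D_1 f t.
Proof.
move=> t0; rewrite /time_derive /derive; congr lim.
rewrite [in RHS](_ : (fun h => _) = (fun h : R => h^-1 * (f (t + h) - f t))).
  congr (_ @ _); rewrite eqEsubset; split => A; last exact: cvg_within.
  rewrite /within /= !near_withinE/= => HA.
  have pos : \forall s \near (0 : R), 0 <= t + s.
    apply/nbhs_ballP; exists t => //= s.
    rewrite -ball_normE /= sub0r normrN ltr_norml => /andP[+ _].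
    by rewrite -subr_gt0 opprK addrC => /ltW.
  suff : nbhs (0 : R) (fun s => s != 0 -> A s) by [].
  by apply: filterS2 HA pos => s H p s0; exact: H s0 p.
apply/funext => s.
by rewrite /= [_%:A]mulr1 (addrC s t).
Qed.

Lemma ord2_cases (k : 'I_2) : k = 0 \/ k = 1.
Proof. by case: k => -[|[|//]] ?; [left|right]; exact/val_inj. Qed.

Lemma sum_ord2 (R : nmodType) (F : 'I_2 -> R) : \sum_(k < 2) F k = F 0 + F 1.
Proof.
rewrite !big_ord_recl big_ord0 addr0; congr (F _ + F _); exact/val_inj.
Qed.

Lemma adj2 (R : comPzRingType) (A : 'M[R]_2) :
  [/\ \adj A 0 0 = A 1 1, \adj A 0 1 = - A 0 1,
      \adj A 1 0 = - A 1 0 & \adj A 1 1 = A 0 0].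
Proof.
have l0 : lift 0 0 = 1 :> 'I_2 by exact/val_inj.
have l1 : lift 1 0 = 0 :> 'I_2 by exact/val_inj.
split; rewrite !mxE /cofactor det_mx11 !mxE /= ?l0 ?l1 ?expr0 ?expr1
  ?mul1r ?mulN1r//.
by rewrite -signr_odd expr0 mul1r.
Qed.

Section Charts.
Context {R : realType} {S : riemannianSurface R}.
Implicit Types (i j : chart S) (q : S) (h : R -> chart S -> S -> R).

Lemma dom_param i x : chart_range i x -> dom i (param i x).
Proof. by move=> [q qi <-]; rewrite chart_mapK. Qed.

Lemma paramK i x : chart_range i x -> chart_map i (param i x) = x.
Proof. by move=> [q qi <-]; rewrite chart_mapK. Qed.

Lemma chart_range_map i q : dom i q -> chart_range i (chart_map i q).
Proof. by exists q. Qed.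

(** Time is restricted to be positive: this makes the domain open, and the growth
estimate needs no information on how the flow behaves as time tends to 0. *)
Definition spacetime i : set (R * (R * R)) :=
  [set z | 0 < z.1 /\ chart_range i z.2].

Lemma open_spacetime i : open (spacetime i).
Proof.
rewrite openE => -[t x] [/= t0 xi].
exists ([set s | 0 < s], chart_range i); last by move=> [].
split => /=; first exact: lt_nbhsr.
by apply: open_nbhs_nbhs; split => //; exact: range_open.
Qed.

Lemma spacetime_map i q t : 0 < t -> dom i q -> spacetime i (t, chart_map i q).
Proof. by move=> t0 qi; split => //; exact: chart_range_map. Qed.

(** A family [h : R -> chart S -> S -> R] is a time-dependent quantity given by
one expression per chart, such as a component of a covector field; functions on
the surface are the families that ignore the chart. Here such an expression is
read in the coordinates of its chart. *)
Definition pull h i (z : R * (R * R)) : R := h z.1 i (param i z.2).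

Definition reg n h : Prop := forall i, Ck n (spacetime i) (pull h i).

Definition dx k h t i q : R :=
  partial k (fun x => h t i (param i x)) (chart_map i q).

Definition dt h t i q : R := 'D_1 (fun s => h s i q) t.

Lemma reg_eq n h h' :
  (forall t i q, 0 < t -> dom i q -> h t i q = h' t i q) -> reg n h -> reg n h'.
Proof.
move=> hh' rh i; apply: Ck_eq (open_spacetime i) _ (rh i) => z /[!inE] -[z0 zi].
by apply: hh' => //; exact: dom_param.
Qed.

Lemma regW n h : reg n.+1 h -> reg n h.
Proof. by move=> rh i; exact: CkW. Qed.

Lemma reg0 n h : reg n h -> reg 0 h.
Proof. by elim: n => // n IH /regW. Qed.

Lemma reg_cst n (c : R) : reg n (fun _ _ _ => c).
Proof. by move=> i; exact: Ck_cst. Qed.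

Lemma regD n h h' : reg n h -> reg n h' -> reg n (fun t i q => h t i q + h' t i q).
Proof. by move=> rh rh' i; apply: CkD => //; exact: open_spacetime. Qed.

Lemma regM n h h' : reg n h -> reg n h' -> reg n (fun t i q => h t i q * h' t i q).
Proof. by move=> rh rh' i; apply: CkM => //; exact: open_spacetime. Qed.

Lemma regN n h : reg n h -> reg n (fun t i q => - h t i q).
Proof. by move=> rh i; apply: CkN => //; exact: open_spacetime. Qed.

Lemma regB n h h' : reg n h -> reg n h' -> reg n (fun t i q => h t i q - h' t i q).
Proof. by move=> rh rh'; apply: regD => //; exact: regN. Qed.

Lemma regV n h : (forall t i q, 0 < t -> dom i q -> h t i q != 0) ->
  reg n h -> reg n (fun t i q => (h t i q)^-1).
Proof.
move=> h0 rh i; apply: CkV => //; first exact: open_spacetime.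
by move=> z [z0 zi]; apply: h0 => //; exact: dom_param.
Qed.

Lemma reg_sqrt n h : (forall t i q, 0 < t -> dom i q -> 0 < h t i q) ->
  reg n h -> reg n (fun t i q => Num.sqrt (h t i q)).
Proof.
move=> h0 rh i; apply: Ck_sqrt => //; first exact: open_spacetime.
by move=> z [z0 zi]; apply: h0 => //; exact: dom_param.
Qed.

Lemma reg_sum n (I : Type) (r : seq I) (h : I -> R -> chart S -> S -> R) :
  (forall k, reg n (h k)) -> reg n (fun t i q => \sum_(k <- r) h k t i q).
Proof.
move=> rh i; apply: (@Ck_sum _ _ n (spacetime i) _ r (fun k => pull (h k) i)).
  exact: open_spacetime.
by move=> k; exact: rh.
Qed.

(** Time-independent quantities are regarded as constant in time, so that one set
of rules serves both kinds. *)
Lemma reg_static n (c : chart S -> S -> R) :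
  (forall i, Ck n (chart_range i) (fun x => c i (param i x))) ->
  reg n (fun _ => c).
Proof.
move=> cc i; apply: (@Ck_subset _ _ _ (snd @^-1` chart_range i)).
  by move=> z [].
apply: (@Ck_affine _ _ _ n (chart_range i) (fun x => c i (param i x)) snd snd).
- by move=> z; exact: cvg_snd.
- by [].
- exact: cc.
Qed.

Lemma reg_slice n h t i : 0 < t -> reg n h ->
  Ck n (chart_range i) (fun x => h t i (param i x)).
Proof.
move=> t0 rh.
apply: (@Ck_subset _ _ _ ((fun x => (t, x)) @^-1` spacetime i)) => //.
apply: (@Ck_affine _ _ _ n (spacetime i) (pull h i) (fun x => (t, x))
  (fun x => (0, x))).
- move=> x; apply: (continuous_slice2 _ _ _ (fun z => z)); exact: cvg_id.
- by move=> s w y; congr pair; rewrite /= scaler0 add0r.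
- exact: rh.
Qed.

(** Freezing the time is an affine substitution, so that no differentiability is
required. *)
Lemma dxE k h t i q :
  dx k h t i q = 'D_((0, axis k) : R * (R * R)) (pull h i) (t, chart_map i q).
Proof.
rewrite /dx /partial; apply: (derive_affine (pull h i) (fun x => (t, x))) => s.
by congr pair; rewrite /= scaler0 add0r.
Qed.

Lemma dtE h t i q : dom i q ->
  dt h t i q = 'D_((1, 0) : R * (R * R)) (pull h i) (t, chart_map i q).
Proof.
move=> qi; rewrite -(derive_affine (pull h i) (fun s : R => (s, chart_map i q)) 1).
  by rewrite /dt /pull /comp/= chart_mapK.
by move=> s; congr pair; rewrite /= scaler0 add0r.
Qed.

Lemma derivable_dt n h t i q : reg n.+1 h -> 0 < t -> dom i q ->
  derivable (fun s => h s i q) t 1.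
Proof.
move=> rh t0 qi.
have -> : (fun s => h s i q) = pull h i \o (fun s => (s, chart_map i q)).
  by apply/funext => s; rewrite /pull /= chart_mapK.
apply: (derivable_affine _ _ _ ((1, 0) : R * (R * R))).
  by move=> s; congr pair; rewrite /= scaler0 add0r.
exact: Ck_derivable (rh i) (spacetime_map _ _ _ t0 qi).
Qed.

Lemma derivable_dx n h t i x v : reg n.+1 h -> 0 < t -> chart_range i x ->
  derivable (fun x => h t i (param i x)) x v.
Proof. by move=> rh t0 xi; exact: Ck_derivable (reg_slice _ _ _ _ t0 rh) xi. Qed.

Lemma reg_dx n k h : reg n.+1 h -> reg n (dx k h).
Proof.
move=> rh i.
apply: Ck_eq (open_spacetime i) _
  (Ck_derive _ _ _ ((0, axis k) : R * (R * R)) (rh i)).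
by move=> [t x] /[!inE] -[/= t0 xi]; rewrite /pull/= dxE paramK.
Qed.

Lemma reg_dt n h : reg n.+1 h -> reg n (dt h).
Proof.
move=> rh i.
apply: Ck_eq (open_spacetime i) _
  (Ck_derive _ _ _ ((1, 0) : R * (R * R)) (rh i)).
move=> [t x] /[!inE] -[/= t0 xi]; rewrite /pull/= dtE ?paramK//.
exact: dom_param.
Qed.

Lemma dx_ext k h h' t i q : dom i q ->
  (forall p, dom i p -> h t i p = h' t i p) -> dx k h t i q = dx k h' t i q.
Proof.
move=> qi hh'; apply: near_eq_derive.
have xi : \forall x \near chart_map i q, chart_range i x.
  by apply: open_nbhs_nbhs; split; [exact: range_open|exact: chart_range_map].
by apply: filterS xi => x xi; apply: hh'; exact: dom_param.
Qed.

Lemma dt_ext h h' t i q : 0 < t ->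
  (forall s, 0 < s -> h s i q = h' s i q) -> dt h t i q = dt h' t i q.
Proof.
move=> t0 hh'; apply: near_eq_derive.
by apply: filterS (lt_nbhsr t0) => s; exact: hh'.
Qed.

Lemma dxD k h h' t i q : reg 1 h -> reg 1 h' -> 0 < t -> dom i q ->
  dx k (fun t i q => h t i q + h' t i q) t i q = dx k h t i q + dx k h' t i q.
Proof.
move=> rh rh' t0 qi; have xi := chart_range_map i q qi.
exact: deriveD (derivable_dx _ _ _ _ _ _ rh t0 xi) (derivable_dx _ _ _ _ _ _ rh' t0 xi).
Qed.

Lemma dxN k h t i q : reg 1 h -> 0 < t -> dom i q ->
  dx k (fun t i q => - h t i q) t i q = - dx k h t i q.
Proof.
move=> rh t0 qi; have xi := chart_range_map i q qi.
exact: deriveN (derivable_dx _ _ _ _ _ _ rh t0 xi).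
Qed.

Lemma dxM k h h' t i q : reg 1 h -> reg 1 h' -> 0 < t -> dom i q ->
  dx k (fun t i q => h t i q * h' t i q) t i q =
  h t i q * dx k h' t i q + h' t i q * dx k h t i q.
Proof.
move=> rh rh' t0 qi; have xi := chart_range_map i q qi.
rewrite [LHS](deriveM (derivable_dx _ _ _ _ _ _ rh t0 xi)
  (derivable_dx _ _ _ _ _ _ rh' t0 xi)).
by rewrite chart_mapK.
Qed.

Lemma dtD h h' t i q : reg 1 h -> reg 1 h' -> 0 < t -> dom i q ->
  dt (fun t i q => h t i q + h' t i q) t i q = dt h t i q + dt h' t i q.
Proof.
move=> rh rh' t0 qi.
exact: deriveD (derivable_dt _ _ _ _ _ rh t0 qi) (derivable_dt _ _ _ _ _ rh' t0 qi).
Qed.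

Lemma dtM h h' t i q : reg 1 h -> reg 1 h' -> 0 < t -> dom i q ->
  dt (fun t i q => h t i q * h' t i q) t i q =
  h t i q * dt h' t i q + h' t i q * dt h t i q.
Proof.
move=> rh rh' t0 qi.
exact: deriveM (derivable_dt _ _ _ _ _ rh t0 qi) (derivable_dt _ _ _ _ _ rh' t0 qi).
Qed.

Lemma dt_static (c : chart S -> S -> R) t i q : dt (fun _ => c) t i q = 0.
Proof. exact: derive_cst. Qed.

Lemma dx_dx k l h t i q : reg 2 h -> 0 < t -> dom i q ->
  dx k (dx l h) t i q = dx l (dx k h) t i q.
Proof.
move=> rh t0 qi.
have E (a b : 'I_2) : dx a (dx b h) t i q = 'D_((0, axis a) : R * (R * R))
    ('D_((0, axis b) : R * (R * R)) (pull h i)) (t, chart_map i q).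
  rewrite dxE; apply: near_eq_derive.
  have := open_nbhs_nbhs (conj (open_spacetime i) (spacetime_map _ _ _ t0 qi)).
  by apply: filterS => -[s x] [/= s0 xi]; rewrite /pull/= dxE paramK.
rewrite !E; apply: derive_comm (open_spacetime i) (rh i) _.
exact: spacetime_map.
Qed.

Lemma dx_dt k h t i q : reg 2 h -> 0 < t -> dom i q ->
  dx k (dt h) t i q = dt (dx k h) t i q.
Proof.
move=> rh t0 qi; rewrite (dxE k (dt h)) (dtE (dx k h) _ _ _ qi).
transitivity ('D_((0, axis k) : R * (R * R))
    ('D_((1, 0) : R * (R * R)) (pull h i)) (t, chart_map i q)).
  apply: near_eq_derive.
  have := open_nbhs_nbhs (conj (open_spacetime i) (spacetime_map _ _ _ t0 qi)).
  apply: filterS => -[s x] [/= s0 xi]; rewrite /pull/= dtE ?paramK//.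
  exact: dom_param.
rewrite (derive_comm _ _ _ _ _ (open_spacetime i) (rh i)); last exact: spacetime_map.
apply: near_eq_derive.
have := open_nbhs_nbhs (conj (open_spacetime i) (spacetime_map _ _ _ t0 qi)).
by apply: filterS => -[s x] [/= s0 xi]; rewrite /pull/= dxE paramK.
Qed.

Lemma smooth_within_reg n h :
  (forall i, smooth_within (halfline_range i) (fun tx => h tx.1 i (param i tx.2))) ->
  reg n h.
Proof.
move=> sh i; apply: Ck_local => z [z0 zi].
have [U [g [oU Uz sg fg]]] := sh i z (conj (ltW z0) zi).
exists (U `&` spacetime i); split => //.
  by apply: openI => //; exact: open_spacetime.
apply: (@Ck_eq _ _ _ _ g).
- by apply: openI => //; exact: open_spacetime.
- move=> y /[!inE] -[Uy [y0 yi]]; apply/esym/fg; rewrite inE; split => //.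
  by split => //; exact: ltW.
- by apply: Ck_subset (smooth_on_Ck n _ _ sg) => y [].
Qed.

End Charts.

(** * Regularity and chart independence of the metric operators *)
Lemma continuous_pairing (X Y Z : topologicalType) (f : X -> Y) (g : X -> Z) x :
  {for x, continuous f} -> {for x, continuous g} ->
  {for x, continuous (fun x => (f x, g x))}.
Proof. by move=> fc gc; apply: cvg_pair; [exact: fc|exact: gc]. Qed.

Section Forms.
Context {R : realType} {S : riemannianSurface R}.
Implicit Types (i j : chart S) (q : S) (alpha beta : R -> form1 S).

Lemma reg_metric n a b : reg n (fun _ (i : chart S) q => metric i q a b).
Proof. by apply: reg_static => i; exact/smooth_on_Ck/metric_smooth. Qed.

Lemma reg_det n : reg n (fun _ (i : chart S) q => \det (metric i q)).
Proof.
apply: (@reg_eq _ _ _ (fun _ (i : chart S) q => metric i q 0 0 * metric i q 1 1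
   - metric i q 0 1 * metric i q 1 0)).
  by move=> t i q _ _; rewrite det2.
by apply: regB; apply: regM; exact: reg_metric.
Qed.

Lemma area_form_gt0 i q : dom i q -> 0 < area_form i q.
Proof. by move=> qi; rewrite sqrtr_gt0 metric_det_gt0. Qed.

Lemma reg_area n : reg n (fun _ (i : chart S) q => area_form i q).
Proof.
by apply: reg_sqrt; [move=> *; exact: metric_det_gt0|exact: reg_det].
Qed.

Lemma reg_inv_metric n a b :
  reg n (fun _ (i : chart S) q => invmx (metric i q) a b).
Proof.
apply: (@reg_eq _ _ _ (fun _ (i : chart S) q =>
    (\det (metric i q))^-1 * \adj (metric i q) a b)).
  by move=> t i q _ qi; rewrite /invmx metric_unit// [RHS]mxE.
apply: regM.
  by apply: regV; [move=> *; rewrite gt_eqF// metric_det_gt0|exact: reg_det].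
have A (i : chart S) (q : S) := adj2 _ (metric i q).
have [->|->] := ord2_cases a; have [->|->] := ord2_cases b.
- by refine (reg_eq _ _ _ _ (reg_metric n 1 1)) => t i q _ _; have [-> _ _ _] := A i q.
- by refine (reg_eq _ _ _ _ (regN _ _ (reg_metric n 0 1))) => t i q _ _; have [_ -> _ _] := A i q.
- by refine (reg_eq _ _ _ _ (regN _ _ (reg_metric n 1 0))) => t i q _ _; have [_ _ -> _] := A i q.
- by refine (reg_eq _ _ _ _ (reg_metric n 0 0)) => t i q _ _; have [_ _ _ ->] := A i q.
Qed.

(** In a chart the star of a covector field is multiplication by this matrix. *)
Definition star_mx i q : 'M[R]_2 :=
  area_form i q *: (invmx (metric i q) *m quarter_turn).

Lemma star1E (a : form1 S) i q : star1 a i q = a i q *m star_mx i q.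
Proof. by rewrite /star1 /star_mx -scalemxAr mulmxA. Qed.

Lemma star1_comp (a : form1 S) i q k : star1 a i q 0 k =
  a i q 0 0 * star_mx i q 0 k + a i q 0 1 * star_mx i q 1 k.
Proof. by rewrite star1E mxE sum_ord2. Qed.

Lemma reg_star_mx n a b : reg n (fun _ i q => star_mx i q a b).
Proof.
apply: (@reg_eq _ _ _ (fun _ (i : chart S) q => area_form i q *
    \sum_(k < 2) invmx (metric i q) a k * quarter_turn k b)).
  by move=> t i q _ _; rewrite !mxE.
apply: regM; first exact: reg_area.
by apply: reg_sum => k; apply: regM; [exact: reg_inv_metric|exact: reg_cst].
Qed.

Definition regF n alpha := forall k, reg n (fun t i q => alpha t i q 0 k).

Lemma regFW n alpha : regF n.+1 alpha -> regF n alpha.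
Proof. by move=> ra k; exact: regW. Qed.

Lemma regF_star n alpha : regF n alpha -> regF n (fun t => star1 (alpha t)).
Proof.
move=> ra k; apply: (@reg_eq _ _ _ (fun t i q => alpha t i q 0 0 * star_mx i q 0 k
  + alpha t i q 0 1 * star_mx i q 1 k)).
  by move=> t i q _ _; rewrite star1_comp.
by apply: regD; (apply: regM; [exact: ra|exact: reg_star_mx]).
Qed.

Lemma d0_comp (f : R -> S -> R) k t i q :
  d0 (f t) i q 0 k = dx k (fun t _ q => f t q) t i q.
Proof. by rewrite mxE. Qed.

Lemma regF_d0 n (f : R -> S -> R) :
  reg n.+1 (fun t _ q => f t q) -> regF n (fun t => d0 (f t)).
Proof.
move=> rf k; refine (reg_eq _ _ _ _ (reg_dx _ k _ rf)) => t i q _ _.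
by rewrite d0_comp.
Qed.

Lemma d1E alpha t i q : d1 (alpha t) i q =
  dx 0 (fun t i q => alpha t i q 0 1) t i q
  - dx 1 (fun t i q => alpha t i q 0 0) t i q.
Proof. by []. Qed.

Lemma inner_in_comp i q (a b : 'rV[R]_2) : inner_in i q a b =
  \sum_(l < 2) (\sum_(k < 2) a 0 k * invmx (metric i q) k l) * b 0 l.
Proof.
by rewrite /inner_in mxE; apply: eq_bigr => l _; rewrite !mxE.
Qed.

Lemma reg_inner_in n alpha beta : regF n alpha -> regF n beta ->
  reg n (fun t i q => inner_in i q (alpha t i q) (beta t i q)).
Proof.
move=> ra rb; apply: (@reg_eq _ _ _ (fun t i q =>
   \sum_(l < 2) (\sum_(k < 2) alpha t i q 0 k * invmx (metric i q) k l)
     * beta t i q 0 l)).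
  by move=> t i q _ _; rewrite inner_in_comp.
apply: reg_sum => l; apply: regM; last exact: rb.
by apply: reg_sum => k; apply: regM; [exact: ra|exact: reg_inv_metric].
Qed.

Lemma reg_inner n alpha beta : regF n alpha -> regF n beta ->
  (forall t, 0 < t -> covector_law (alpha t)) ->
  (forall t, 0 < t -> covector_law (beta t)) ->
  reg n (fun t _ q => inner (alpha t) (beta t) q).
Proof.
move=> ra rb la lb; refine (reg_eq _ _ _ _ (reg_inner_in _ _ _ ra rb)) => t i q t0 qi.
by rewrite (inner_chart (la _ t0) (lb _ t0) qi).
Qed.

Lemma inner_inC i q (a b : 'rV[R]_2) : dom i q -> inner_in i q a b = inner_in i q b a.
Proof.
move=> qi; rewrite /inner_in.
have gVs : (invmx (metric i q))^T = invmx (metric i q).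
  by rewrite trmx_inv Defs.metric_sym.
by rewrite -[in LHS](trmxK (a *m invmx (metric i q) *m b^T)) [LHS]mxE !trmx_mul trmxK gVs mulmxA.
Qed.

Lemma inner_inDl i q (a a' b : 'rV[R]_2) :
  inner_in i q (a + a') b = inner_in i q a b + inner_in i q a' b.
Proof. by rewrite /inner_in !mulmxDl mxE. Qed.

Lemma inner_inZl i q c (a b : 'rV[R]_2) :
  inner_in i q (c *: a) b = c * inner_in i q a b.
Proof. by rewrite /inner_in -!scalemxAl mxE. Qed.

Lemma inner_inNl i q (a b : 'rV[R]_2) : inner_in i q (- a) b = - inner_in i q a b.
Proof. by rewrite -scaleN1r inner_inZl mulN1r. Qed.

Lemma inner_in_ge0 i q (a : 'rV[R]_2) : dom i q -> 0 <= inner_in i q a a.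
Proof.
move=> qi; have [->|a0] := eqVneq a 0.
  by rewrite /inner_in !mul0mx mxE.
have gu := metric_unit qi.
have gVs : (invmx (metric i q))^T = invmx (metric i q).
  by rewrite trmx_inv Defs.metric_sym.
have b0 : a *m invmx (metric i q) != 0.
  apply: contra_neq a0 => E.
  by rewrite -[a](mulmxKV gu) E mul0mx.
have := metric_pos qi b0.
by rewrite trmx_mul gVs (mulmxKV gu) mulmxA => /ltW.
Qed.

(** Expand the square of [s a - e b] for both signs [e] and divide by [s]. *)
Lemma inner_in_young i q (a b : 'rV[R]_2) (s : R) : dom i q -> 0 < s ->
  2 * `|inner_in i q a b| <= s * inner_in i q a a + s^-1 * inner_in i q b b.
Proof.
move=> qi s0.
have H (e : R) : e ^+ 2 = 1 -> 2 * (e * inner_in i q a b) <=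
    s * inner_in i q a a + s^-1 * inner_in i q b b.
  move=> e2; have := inner_in_ge0 i q (s *: a - e *: b) qi.
  rewrite -[- _](scaleN1r (e *: b)) scalerA mulN1r.
  have exp2 (x y : R) (u w : 'rV[R]_2) : inner_in i q (x *: u + y *: w) (x *: u + y *: w) =
      x ^+ 2 * inner_in i q u u + 2 * x * y * inner_in i q u w
      + y ^+ 2 * inner_in i q w w.
    rewrite inner_inDl !inner_inZl ![inner_in i q _ (_ + _)]inner_inC//.
    rewrite !inner_inDl !inner_inZl (inner_inC i q w u)//; ring.
  rewrite exp2 sqrrN e2 mul1r => H.
  have aux (A B C : R) : 0 <= s ^+ 2 * A + 2 * s * (- e) * C + B ->
      2 * (e * C) <= s * A + s^-1 * B.
    move=> h; rewrite -subr_ge0 -(pmulr_rge0 _ s0).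
    have -> : s * (s * A + s^-1 * B - 2 * (e * C)) =
        s ^+ 2 * A + 2 * s * (- e) * C + B by field; rewrite gt_eqF.
    by [].
  exact: aux.
case: (ger0P (inner_in i q a b)) => _.
  by have := H 1 (expr1n _ _); rewrite mul1r.
by have := H (-1) (etrans (sqrrN 1) (expr1n _ _)); rewrite mulN1r.
Qed.

Lemma jac_det_gt0 i j q : dom i q -> dom j q -> 0 < \det (jac i j q).
Proof. exact: transition_oriented. Qed.

Lemma covector_lawD (a b : form1 S) : covector_law a -> covector_law b ->
  covector_law (fun i q => a i q + b i q).
Proof. by move=> la lb i j q qi qj; rewrite (la i j)// (lb i j)// mulmxDl. Qed.

(** The quarter turn is the matrix of the standard symplectic form of the plane,
which a linear map multiplies by its determinant. *)
Lemma quarter_turn_conj (J : 'M[R]_2) : \det J *: quarter_turn = J *m quarter_turn *m J^T.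
Proof.
rewrite det2; apply/matrixP => a b; rewrite !mxE !sum_ord2 !mxE !sum_ord2 !mxE.
by have [->|->] := ord2_cases a; have [->|->] := ord2_cases b; rewrite /=; ring.
Qed.

(** The determinant by which the area form changes is the one produced by the
quarter turn; it is not replaced by its absolute value because the atlas is
oriented. *)
Lemma covector_law_star (a : form1 S) : covector_law a -> covector_law (star1 a).
Proof.
move=> la i j q qi qj; rewrite !star1E /star_mx (la i j)//.
set J := jac i j q; have dJ : 0 < \det J := jac_det_gt0 i j q qi qj.
have Ju : J \in unitmx by rewrite unitmxE unitfE gt_eqF.
have Jtu : J^T \in unitmx by rewrite unitmx_tr.
have gu := metric_unit qj.
have -> : area_form i q = \det J * area_form j q.
  rewrite /area_form (metric_change qi qj) !det_mulmx det_tr mulrC mulrA.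
  by rewrite -expr2 sqrtrM ?sqr_ge0// sqrtr_sqr gtr0_norm.
rewrite (metric_change qi qj) -/J.
have -> : invmx (J *m metric j q *m J^T) = invmx J^T *m invmx (metric j q) *m invmx J.
  have h_unit : J *m metric j q *m J^T \in unitmx by rewrite !unitmx_mul Ju gu Jtu.
  apply: (can_inj (mulKmx h_unit)); rewrite mulmxV//.
  by rewrite -!mulmxA (mulKVmx Jtu) (mulKVmx gu) mulmxV.
rewrite -!scalemxAr -scalemxAl [\det J * _]mulrC -scalerA; congr (_ *: _).
rewrite -!mulmxA (mulKVmx Jtu) !scalemxAr.
by rewrite quarter_turn_conj -!mulmxA (mulKmx Ju).
Qed.

(** With [O] the domain of another chart, this says that a chart overlap is open
in coordinates. *)
Lemma open_param_preimage i (O : set S) : open O ->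
  open (chart_range i `&` param i @^-1` O).
Proof.
move=> oO; rewrite openE => x [xi Ox]; apply: filterI.
  by apply: open_nbhs_nbhs; split => //; exact: range_open.
by apply: (param_continuous xi); exact: open_nbhs_nbhs.
Qed.

(** Near the point, [f] read in chart [i] is [f] read in chart [j] composed with
the transition map. *)
Lemma covector_law_d0 (f : R -> S -> R) t : reg 1 (fun t _ q => f t q) -> 0 < t ->
  covector_law (d0 (f t)).
Proof.
move=> rf t0 i j q qi qj; apply/rowP => k.
rewrite [RHS]mxE sum_ord2 ![(jac _ _ _)^T _ _]mxE ![d0 _ _ _ _ _]mxE.
pose T (x : R * R) := chart_map j (param i x).
have xi := chart_range_map i q qi.
have Tq : T (chart_map i q) = chart_map j q by rewrite /T chart_mapK.
have Td (l : 'I_2) : is_derive (chart_map i q) (axis k)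
    (fun x => coordinate l (T x)) (jac i j q k l).
  rewrite /jac !mxE; apply: derivableP.
  have xij : (chart_map i @` (dom i `&` dom j)) (chart_map i q) by exists q.
  exact: (@transition_smooth R S i j l [::] _ xij).2.
have Cf : Ck 1 (chart_range j) (f t \o param j).
  exact: reg_slice t0 rf.
have UT : chart_range j (T (chart_map i q)) by rewrite Tq; exact: chart_range_map.
have := is_derive_chain _ _ T (chart_map i q) (axis k) _ _
  (range_open (o := S) (i := j) : open (chart_range j)) Cf UT
  (Td 0) (Td 1).
move=> [_ E]; rewrite /partial.
rewrite (@near_eq_derive _ _ _ (f t \o param i) ((f t \o param j) \o T)).
  by rewrite E Tq mulrC; congr (_ + _); rewrite mulrC.
have oj : open (chart_range i `&` param i @^-1` dom j).
  exact/open_param_preimage/dom_open.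
have : nbhs (chart_map i q) (chart_range i `&` param i @^-1` dom j).
  by apply: open_nbhs_nbhs; split => //; split => //=; rewrite chart_mapK.
by apply: filterS => x [_ xj]; rewrite /= /T chart_mapK.
Qed.

Lemma reg_continuous (G : R -> S -> R) t q : reg 0 (fun t _ q => G t q) -> 0 < t ->
  {for (t, q), continuous (fun z : R * S => G z.1 z.2)}.
Proof.
move=> rG t0; pose i := chart_at q; have qi : dom i q := dom_chart_at q.
pose g (z : R * S) := (z.1, chart_map i z.2).
have gc : {for (t, q), continuous g}.
  apply: continuous_pairing; first exact: cvg_fst.
  have sc : {for (t, q), continuous (snd : R * S -> S)} by exact: cvg_snd.
  exact: (continuous_comp sc (chart_map_continuous qi)).
have hc := continuous_comp gc
  (Ck_continuous _ _ _ _ (rG i) (spacetime_map i q t t0 qi)).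
have E : {near (t, q), pull (fun t _ q => G t q) i \o g =1 (fun z => G z.1 z.2)}.
  have : nbhs (t, q) (setT `*` dom i).
    by exists (setT, dom i) => //; split; [exact: filterT|apply:
        open_nbhs_nbhs; split => //; exact: dom_open].
  by apply: filterS => z [_ zi]; rewrite /pull /= chart_mapK.
rewrite /prop_for /continuous_at -[G _ _](nbhs_singleton E).
by apply: cvg_trans hc; apply: near_eq_cvg; exact: E.
Qed.

Lemma reg_continuous_slice (G : R -> S -> R) t : reg 0 (fun t _ q => G t q) -> 0 < t ->
  continuous (G t).
Proof.
move=> rG t0 q; exact: (continuous_slice2 _ _ _ _ _ _ (reg_continuous _ _ q rG t0)).
Qed.

End Forms.

(** * Cutoff functions *)
Section Bump.
Context {R : realType}.
Implicit Types x y : R * R.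

(** It is supported in a disc inside the square of half-side [r] at [x], and is
C^1 but not C^2. *)
Definition cutoff x (r : R) y : R :=
  Num.max 0 (r ^+ 2 - (y.1 - x.1) ^+ 2 - (y.2 - x.2) ^+ 2) ^+ 2.

Definition square x (r : R) : set (R * R) :=
  box (x.1 - r, x.2 - r) (x.1 + r, x.2 + r).

Lemma cutoff_ge0 x r y : 0 <= cutoff x r y.
Proof. exact: sqr_ge0. Qed.

Lemma cutoff_center x r : 0 < r -> 0 < cutoff x r x.
Proof.
move=> r0; rewrite /cutoff !subrr expr0n/= !subr0 exprn_gt0// lt_max exprn_gt0//.
by rewrite orbT.
Qed.

Lemma cutoff_out x r y : r ^+ 2 <= (y.1 - x.1) ^+ 2 \/ r ^+ 2 <= (y.2 - x.2) ^+ 2 ->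
  cutoff x r y = 0.
Proof.
move=> H; rewrite /cutoff (max_idPl _) ?expr0n//.
have := sqr_ge0 (y.1 - x.1); have := sqr_ge0 (y.2 - x.2).
by case: H; lra.
Qed.

Lemma cutoff_square x r y : 0 < r -> cutoff x r y != 0 -> square x r y.
Proof.
move=> r0; apply: contra_neqP => nxy; apply: cutoff_out.
have out (u : R) (c : R) : ~ (c - r <= u <= c + r) -> r ^+ 2 <= (u - c) ^+ 2.
  move=> nu; rewrite -[leLHS]real_normK ?num_real// -[leRHS]real_normK ?num_real//.
  rewrite lerXn2r ?nnegrE// (gtr0_norm r0) leNgt; apply/negP => H; apply: nu.
  by move: H; rewrite ltr_distl => /andP[/ltW -> /ltW ->].
have [h1|h1] := pselect (x.1 - r <= y.1 <= x.1 + r); last by left; exact: out.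
right; apply: out => h2; apply: nxy.
by split; rewrite /= in_itv.
Qed.

Lemma cutoff_edge1 x r (s : R) : cutoff x r (x.1 - r, s) = 0 /\ cutoff x r (x.1 + r, s) = 0.
Proof.
by split; apply: cutoff_out; left; rewrite /= addrAC subrr add0r ?sqrrN.
Qed.

Lemma cutoff_edge2 x r (s : R) : cutoff x r (s, x.2 - r) = 0 /\ cutoff x r (s, x.2 + r) = 0.
Proof.
by split; apply: cutoff_out; right; rewrite /= addrAC subrr add0r ?sqrrN.
Qed.

Lemma C1_cutoff (V : normedModType R) (U : set V) (f g : V -> R) x r : open U ->
  Ck 1 U f -> Ck 1 U g -> Ck 1 U (fun z => cutoff x r (f z, g z)).
Proof.
move=> oU Cf Cg.
have sq (h : V -> R) c : Ck 1 U h -> Ck 1 U (fun z => (h z - c) ^+ 2).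
  move=> Ch; have Chc := CkB _ _ _ _ oU Ch (Ck_cst 1 U c).
  exact: (Ck_eq 1 U (fun z => (h z - c) * (h z - c)) _ oU
    (fun z _ => esym (expr2 (h z - c))) (CkM _ _ _ _ oU Chc Chc)).
exact: (C1_pos_sqr U (fun z => r ^+ 2 - (f z - x.1) ^+ 2 - (g z - x.2) ^+ 2) oU
  (CkB _ _ _ _ oU (CkB _ _ _ _ oU (Ck_cst 1 U (r ^+ 2)) (sq f x.1 Cf))
    (sq g x.2 Cg))).
Qed.

End Bump.

Section SurfaceBump.
Context {R : realType} {S : riemannianSurface R}.
Implicit Types (i j : chart S) (q p : S).

Definition square_in i (x : R * R) r := 0 < r /\ square x r `<=` chart_range i.

Lemma exists_square i q : dom i q -> exists r, square_in i (chart_map i q) r.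
Proof.
move=> qi; have : nbhs (chart_map i q) (chart_range i).
  by apply: open_nbhs_nbhs; split; [exact: range_open|exact: chart_range_map].
move=> /nbhs_ballP[e /= e0 eR]; exists (e / 2).
have e20 : 0 < e / 2 by rewrite divr_gt0.
split => // -[y1 y2] []; rewrite /= !in_itv/= => /andP[a1 b1] /andP[a2 b2].
have e2e : e / 2 < e by rewrite ltr_pdivrMr// ltr_pMr// ltr1n.
apply: eR; split; rewrite -ball_normE /= ltr_distlC.
  by rewrite (lt_le_trans _ a1) ?ltrD2l ?ltrN2// (le_lt_trans b1)// ltrD2l.
by rewrite (lt_le_trans _ a2) ?ltrD2l ?ltrN2// (le_lt_trans b2)// ltrD2l.
Qed.

Definition surface_bump i x r (p : S) : R :=
  if p \in dom i then cutoff x r (chart_map i p) else 0.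

Lemma surface_bump_ge0 i x r p : 0 <= surface_bump i x r p.
Proof. by rewrite /surface_bump; case: ifP => // _; exact: cutoff_ge0. Qed.

Lemma surface_bump_in i x r p : dom i p ->
  surface_bump i x r p = cutoff x r (chart_map i p).
Proof. by move=> pi; rewrite /surface_bump mem_set. Qed.

Lemma compact_chart_square i x r : square_in i x r -> compact (param i @` square x r).
Proof.
move=> [r0 sR]; apply: continuous_compact; last exact: compact_box.
by apply: continuous_in_subspaceT => y /[!inE] /sR; exact: param_continuous.
Qed.

Lemma closed_chart_square i x r : square_in i x r -> closed (param i @` square x r).
Proof.
move=> sR; apply: compact_closed; last exact: compact_chart_square.
exact: surface_hausdorff.
Qed.

Lemma chart_square_dom i x r : square_in i x r -> param i @` square x r `<=` dom i.
Proof. by move=> [r0 sR] _ [y /sR yi <-]; exact: dom_param. Qed.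

Lemma surface_bump_out i x r p : square_in i x r ->
  ~ (param i @` square x r) p -> surface_bump i x r p = 0.
Proof.
move=> [r0 sR] np; rewrite /surface_bump; case: ifPn => // /[!inE] pi.
apply/eqP/negPn/negP => b0; apply: np.
by exists (chart_map i p); [exact: cutoff_square b0|exact: chart_mapK].
Qed.

(** Where chart [i] is defined, the bump is the cutoff composed with a transition
map. Elsewhere one is outside the compact, hence closed, image of the square, so
the bump vanishes nearby. *)
Lemma reg_surface_bump i x r : square_in i x r ->
  reg 1 (fun _ _ p => surface_bump i x r p).
Proof.
move=> sq; apply: (reg_static 1 (fun _ p => surface_bump i x r p)) => j.
apply: Ck_local => y yj; have [pi|npi] := pselect (dom i (param j y)).
- have oU : open (chart_range j `&` param j @^-1` dom i).
    exact/open_param_preimage/dom_open.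
  exists (chart_range j `&` param j @^-1` dom i); split => //.
  have C1 (k : 'I_2) : Ck 1 (chart_range j `&` param j @^-1` dom i)
      (fun z => coordinate k (chart_map i (param j z))).
    apply: (@Ck_subset _ _ _ (chart_map j @` (dom j `&` dom i))).
      move=> z [zj zi]; exists (param j z); last exact: paramK.
      by split => //; exact: dom_param.
    exact/smooth_on_Ck/transition_smooth.
  apply: Ck_eq oU _ (C1_cutoff _ _ _ _ x r oU (C1 0) (C1 1)) => z /[!inE] -[zj zi].
  by rewrite surface_bump_in//; case: (chart_map i _).
- have oU : open (chart_range j `&` param j @^-1` (~` (param i @` square x r))).
    by apply: open_param_preimage; apply: closed_openC; exact: closed_chart_square.
  exists (chart_range j `&` param j @^-1` (~` (param i @` square x r))); split => //.
    by split => //= H; apply: npi; exact: chart_square_dom H.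
  apply: Ck_eq oU _ (Ck_cst 1 _ 0) => z /[!inE] -[zj zi].
  by rewrite surface_bump_out.
Qed.

End SurfaceBump.

(** * Integration on a compact surface *)
Section Integration.
Context {R : realType} {S : riemannianSurface R}.
Variable mu : {measure set (borel S) -> \bar R}.
Hypotheses (compactS : compact [set: S]) (mu_area : area_measure mu).
Notation mplane := (measurableTypeR R * measurableTypeR R)%type.
Notation leb2 := ((@lebesgue_measure R) \x (@lebesgue_measure R))%E.
Implicit Types (i j : chart S) (q p : S).

Lemma open_measurable_surface (O : set S) : open O -> measurable (O : set (borel S)).
Proof. by move=> oO; exact: sub_sigma_algebra. Qed.

Lemma closed_measurable_surface (O : set S) : closed O -> measurable (O : set (borel S)).
Proof.
move=> cO; rewrite -(setCK O); apply: measurableC.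
by apply: open_measurable_surface; exact: closed_openC.
Qed.

Lemma continuous_measurable_surface (f : S -> R) : continuous f ->
  measurable_fun [set: borel S] f.
Proof.
move=> fc; apply: measurable_fun_open => B oB; rewrite setTI.
by apply: open_measurable_surface; move/continuousP : fc; apply.
Qed.

Lemma area_continuous i x : chart_range i x ->
  {for x, continuous (fun x => area_form i (param i x))}.
Proof.
move=> xi; exact: Ck_continuous (reg_slice 0 _ 1 i ltr01 (reg_area 0)) xi.
Qed.

(** On a square inside one chart, the area measure is the image of the Lebesgue
measure with the area density. *)
Lemma measure_chart_square i x r (A : set S) : square_in i x r ->
  measurable (A : set (borel S)) -> A `<=` param i @` square x r ->
  mu A = (\int[leb2]_(y in square x r `&` param i @^-1` A)
            (area_form i (param i y))%:E)%E.
Proof.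
move=> sq mA AK; have AD : A `<=` dom i.
  by apply: subset_trans AK _; exact: chart_square_dom.
rewrite (mu_area i A mA AD); congr (integral _ _ _).
have sR := sq.2.
apply/seteqP; split => [_ [q Aq <-]|y [yK yA]].
  have [y yK yq] := AK _ Aq.
  rewrite -yq paramK; last exact: sR.
  by split => //=; rewrite yq.
by exists (param i y) => //; rewrite paramK//; exact: sR.
Qed.

Lemma measure_chart_square_fin i x r : square_in i x r ->
  (mu (param i @` square x r : set (borel S)) < +oo)%E.
Proof.
move=> sq; have [r0 sR] := sq.
rewrite (measure_chart_square _ _ _ _ sq)//; last first.
  by apply: closed_measurable_surface; exact: closed_chart_square.
rewrite (_ : _ `&` _ = square x r); last first.
  by apply/seteqP; split => [y []//|y yK]; split => //; exists y.
have := integrable_box _ _ _ _ (range_open (o := S) (i := i)) sR (area_continuous i).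
move/integrableP => [_]; apply: le_lt_trans; apply: ge0_le_integral => //.
- exact: measurable_box.
- move=> y yK; rewrite lee_fin; apply/ltW/area_form_gt0/dom_param; exact: sR.
- apply/measurable_EFinP; apply: measurable_funS (continuous_measurable_plane _
    _ (range_open (o := S) (i := i)) (area_continuous i)) => //.
  by apply: open_measurable_plane; exact: range_open.
- apply/measurable_EFinP/measurableT_comp => //.
  apply: measurable_funS (continuous_measurable_plane _ _ (range_open (o := S)
      (i := i)) (area_continuous i)) => //.
  by apply: open_measurable_plane; exact: range_open.
- by move=> y yK /=; rewrite lee_fin ler_norm.
Qed.

Record square_data := SquareData {
  sq_chart : chart S; sq_center : R * R; sq_radius : R;
  sq_in : square_in sq_chart sq_center sq_radius }.

Definition sq_bump (d : square_data) : S -> R :=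
  surface_bump (sq_chart d) (sq_center d) (sq_radius d).

Definition sq_set (d : square_data) : set S :=
  param (sq_chart d) @` square (sq_center d) (sq_radius d).

(** Dividing such bumps by their sum gives a partition of unity of class C^1. *)
Lemma finite_bumps : exists s : seq square_data,
  forall p : S, 0 < \sum_(d <- s) sq_bump d p.
Proof.
have /choice[dat Hdat] : forall q : S, exists d, 0 < sq_bump d q.
  move=> q; have [r sq] := exists_square _ _ (dom_chart_at q).
  exists (SquareData _ _ _ sq); rewrite /sq_bump /= surface_bump_in; last exact: dom_chart_at.
  by apply: cutoff_center; have [] := sq.
have bc d : continuous (sq_bump d).
  apply: (reg_continuous_slice (fun _ => sq_bump d) 1) => //.
  exact/reg0/reg_surface_bump/sq_in.
have := compactS; rewrite compact_cover => /(_ S setT (fun q => [set p | 0 < sq_bump (dat q) p])).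
case.
- move=> q _; apply: (@open_comp _ _ (sq_bump (dat q)) [set y | 0 < y]).
    by move=> p _; exact: bc.
  exact: open_gt.
- by move=> q _; exists q => //=.
- move=> D' _ cov; exists [seq dat q | q <- finmap.enum_fset D'] => p.
  have [q qD' /= bq] := cov p I.
  have qs : q \in finmap.enum_fset D' by move: qD'; rewrite /mkset /=.
  rewrite big_map (big_rem q qs)/=.
  rewrite ltr_wpDr//; apply: sumr_ge0 => ? _; exact: surface_bump_ge0.
Qed.

(** The finitely many squares of [finite_bumps] cover the surface, since outside
all of them every bump vanishes. *)
Lemma mu_finite : (mu [set: borel S] < +oo)%E.
Proof.
have [s Hs] := finite_bumps.
have mK d : measurable (sq_set d : set (borel S)).
  by apply: closed_measurable_surface; exact/closed_chart_square/sq_in.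
have fin : forall s : seq square_data,
    measurable (\big[setU/set0]_(d <- s) sq_set d : set (borel S)) /\
    (mu (\big[setU/set0]_(d <- s) sq_set d) < +oo)%E.
  elim=> [|d s' [mU IH]]; first by rewrite big_nil measure0.
  rewrite big_cons; split; first exact: measurableU.
  apply: le_lt_trans (measureU2 _ _ _) _ => //.
  by rewrite lte_add_pinfty// measure_chart_square_fin//; exact: sq_in.
have [_] := fin s; apply: le_lt_trans; apply: le_measure.
- by rewrite inE.
- by rewrite inE; have [] := fin s.
move=> p _.
have [[d ds dp]|H] := pselect (exists2 d, List.In d s & sq_set d p).
  elim: s ds {Hs} => // d' s IH /= [->|ds]; rewrite big_cons; first by left.
  by right; exact: IH.
exfalso; have := Hs p; suff -> : \sum_(d <- s) sq_bump d p = 0 by rewrite ltxx.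
elim: s H {Hs} => [|d s IH] H; first by rewrite big_nil.
rewrite big_cons IH ?addr0; last by move=> [d' ? ?]; apply: H; exists d' => //; right.
apply: surface_bump_out; first exact: sq_in.
by move=> dp; apply: H; exists d => //; left.
Qed.

Lemma continuous_bounded_surface (f : S -> R) : continuous f ->
  exists M, forall p, `|f p| <= M.
Proof.
move=> fc; have [p0|] := pselect ([set: S] !=set0); last first.
  by move=> H; exists 0 => p; exfalso; apply: H; exists p.
have nc : {within [set: S], continuous (fun p => `|f p|)}.
  apply: continuous_in_subspaceT => p _.
  by apply: (continuous_comp (fc p)); exact: norm_continuous.
have [c _ cM] := compact_EVT_max p0 compactS nc.
by exists `|f c| => p; apply: cM; rewrite inE.
Qed.

Lemma continuous_integrable_surface (f : S -> R) : continuous f ->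
  mu.-integrable [set: borel S] (EFin \o f).
Proof.
move=> fc; apply: measurable_bounded_integrable => //.
- exact: mu_finite.
- exact: continuous_measurable_surface.
- have [M HM] := continuous_bounded_surface _ fc.
  exists M; split; first exact: num_real.
  by move=> M' MM' p _; exact: le_trans (HM p) (ltW MM').
Qed.

Lemma integral_chart_square (f : S -> R) d : continuous f ->
  (forall p, ~ sq_set d p -> f p = 0) ->
  (\int[mu]_p (f p)%:E = \int[leb2]_(y in square (sq_center d) (sq_radius d))
     (f (param (sq_chart d) y) * area_form (sq_chart d) (param (sq_chart d) y))%:E)%E.
Proof.
case: d => i x r sq; rewrite /sq_set /= => fc f0; have [r0 sR] := sq.
have mE : measurable (param i @` square x r : set (borel S)).
  by apply: closed_measurable_surface; exact: closed_chart_square.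
rewrite -(@integral_transfer _ _ mplane (borel S) R leb2 mu (square x r)
  (param i @` square x r) (param i) (fun y => area_form i (param i y))).
- rewrite [RHS]integral_mkcond; apply: eq_integral => p _; rewrite patchE.
  by case: ifPn => // /negP; rewrite inE => np; rewrite f0.
- exact: measurable_box.
- exact: mE.
- by move=> y yK; exists y.
- move=> mD; apply: (@measurability _ _ mplane (borel S) (square x r) (param i) (@open S)) => //.
  move=> _ [B oB <-].
  rewrite (_ : _ `&` _ = square x r `&` (chart_range i `&` param i @^-1` B)).
    apply: measurableI => //.
    by apply: open_measurable_plane; exact: open_param_preimage.
  by apply/seteqP; split => [y [yK yO]|y [yK [_ yO]]]; split => //; split => //; exact: sR.
- move=> y yK; apply/ltW/area_form_gt0/dom_param; exact: sR.
- apply: measurable_funS (continuous_measurable_plane _ _ (range_open (o := S)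
    (i := i)) (area_continuous i)) => //.
  by apply: open_measurable_plane; exact: range_open.
- by move=> A mA AK; exact: measure_chart_square.
- exact: measurable_funS (continuous_measurable_surface _ fc).
Qed.

End Integration.

(** * Integration by parts against a coclosed covector field *)
Section Stokes.
Context {R : realType} {S : riemannianSurface R}.
Variable mu : {measure set (borel S) -> \bar R}.
Hypotheses (compactS : compact [set: S]) (mu_area : area_measure mu).
Notation leb2 := ((@lebesgue_measure R) \x (@lebesgue_measure R))%E.
Implicit Types (i j : chart S) (q p : S).

Variable alpha : form1 S.
Hypotheses (ra : regF 1 (fun _ => alpha)) (la : covector_law alpha).
Hypothesis coclosed : forall i q, dom i q -> d1 (star1 alpha) i q = 0.

Lemma continuous_inner_d0 (f : S -> R) : reg 1 (fun _ _ q => f q) ->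
  continuous (inner (d0 f) alpha).
Proof.
move=> rf; apply: (reg_continuous_slice (fun _ => inner (d0 f) alpha) 1) => //.
apply: (reg_inner 0 (fun _ => d0 f) (fun _ => alpha)) => //.
- exact: (regF_d0 0 (fun _ => f)).
- exact: regFW.
- by move=> t t0; exact: (covector_law_d0 (fun _ => f) t).
Qed.

(** As [d (star alpha) = 0], the form [df /\ star alpha] is the exterior
derivative of [f star alpha]. *)
Lemma wedge_d0_star (f : S -> R) i q : reg 1 (fun _ _ q => f q) -> dom i q ->
  inner (d0 f) alpha q * area_form i q =
  partial 0 (fun x => f (param i x) * star1 alpha i (param i x) 0 1) (chart_map i q)
  - partial 1 (fun x => f (param i x) * star1 alpha i (param i x) 0 0) (chart_map i q).
Proof.
move=> rf qi.
have lf : covector_law (d0 f) by exact: (covector_law_d0 (fun _ => f) 1).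
rewrite (inner_chart lf la qi) -wedge_star//.
have rs := regF_star 1 _ ra.
have E1 := dxM 0 _ _ 1 i q rf (rs 1) ltr01 qi.
have E0 := dxM 1 _ _ 1 i q rf (rs 0) ltr01 qi.
have := coclosed i q qi; rewrite (d1E (fun _ => star1 alpha) 1) => H.
rewrite [partial 0 _ _]E1 [partial 1 _ _]E0.
rewrite /wedge (d0_comp (fun _ => f) 0 1) (d0_comp (fun _ => f) 1 1).
move: H; set a := dx 0 _ _ _ _; set b := dx 1 _ _ _ _ => H.
move: H => /eqP; rewrite subr_eq0 => /eqP ->; ring.
Qed.

(** In the coordinates of the square the integrand is a divergence of C^1
functions that vanish on the boundary of the square. *)
Lemma stokes_square d (g : S -> R) : reg 1 (fun _ _ q => g q) ->
  (\int[mu]_p (inner (d0 (fun p => sq_bump d p * g p)) alpha p)%:E = 0)%E.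
Proof.
move=> rg; set f := fun p => sq_bump d p * g p.
have rb : reg 1 (fun _ _ p => sq_bump d p) by exact/reg_surface_bump/sq_in.
have rf : reg 1 (fun _ _ p => f p) by exact: regM.
rewrite (integral_chart_square mu mu_area _ d (continuous_inner_d0 _ rf)); last first.
  move=> p np; rewrite /inner.
  rewrite (_ : d0 f _ _ = 0); first by rewrite /inner_in !mul0mx mxE.
  apply/rowP => k; rewrite !mxE /partial.
  rewrite (@near_eq_derive _ _ _ _ (fun=> 0)) ?derive_cst//.
  have pi : dom (chart_at p) p := dom_chart_at p.
  have oU : open (chart_range (chart_at p) `&` param (chart_at p) @^-1` (~` sq_set d)).
    by apply: open_param_preimage; apply: closed_openC; apply: closed_chart_square; exact: sq_in.
  have : nbhs (chart_map (chart_at p) p)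
      (chart_range (chart_at p) `&` param (chart_at p) @^-1` (~` sq_set d)).
    apply: open_nbhs_nbhs; split => //; split; first exact: chart_range_map.
    by rewrite /= chart_mapK.
  apply: filterS => y [_ yd]; rewrite /= /f /sq_bump surface_bump_out ?mul0r//.
  exact: sq_in.
have fE p : f p = sq_bump d p * g p by [].
case: d f rb rf fE => i x r sq; rewrite /sq_bump /= => f rb rf fE; have [r0 sR] := sq.
(* The cutoff formula replaces the bump because it vanishes on the sides of the
   square whatever param does outside the range of the chart. *)
pose phi k y := cutoff x r y * (g (param i y) * star1 alpha i (param i y) 0 k).
have oR : open (chart_range i) by exact: range_open.
have fphi k : {in chart_range i, (fun y => f (param i y) * star1 alpha i (param i y) 0 k) =1 phi k}.
  move=> y /[!inE] yi; rewrite fE surface_bump_in ?paramK// /phi ?mulrA//.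
  exact: dom_param.
have Cphi k : Ck 1 (chart_range i) (phi k).
  apply: (Ck_eq _ _ _ _ oR (fphi k)).
  exact: (reg_slice 1 _ 1 i ltr01 (regM _ _ _ rf (regF_star 1 _ ra k))).
have Dphi k a y : chart_range i y ->
    partial a (fun y => f (param i y) * star1 alpha i (param i y) 0 k) y =
    'D_(axis a) (phi k) y.
  move=> yi; apply: near_eq_derive.
  have : nbhs y (chart_range i) by exact: open_nbhs_nbhs.
  by apply: filterS => z zi; apply: fphi; rewrite inE.
have I1 := integrable_box _ _ _ _ oR sR (fun y => Ck_continuous 0 _ _ y
    (Ck_derive _ _ _ ((1, 0) : R * R) (Cphi 1))).
have I0 := integrable_box _ _ _ _ oR sR (fun y => Ck_continuous 0 _ _ y
    (Ck_derive _ _ _ ((0, 1) : R * R) (Cphi 0))).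
transitivity (\int[leb2]_(y in square x r) (('D_((1, 0) : R * R) (phi 1) y)%:E
   - ('D_((0, 1) : R * R) (phi 0) y)%:E))%E.
  apply: eq_integral => y /[!inE] yK; have yi := sR _ yK.
  rewrite -EFinB wedge_d0_star ?paramK//; last exact: dom_param.
  by rewrite !Dphi.
rewrite integralB//; last exact: measurable_box.
rewrite (integral_box_dx _ _ _ _ oR (Cphi 1) sR); last 2 first.
- by rewrite /= ltrBlDr -addrA ltrDl addr_gt0.
- by move=> s; rewrite /phi; have [-> ->] := cutoff_edge1 x r s; rewrite !mul0r.
rewrite (integral_box_dy _ _ _ _ oR (Cphi 0) sR) ?subee//.
- by rewrite /= ltrBlDr -addrA ltrDl addr_gt0.
- by move=> s; rewrite /phi; have [-> ->] := cutoff_edge2 x r s; rewrite !mul0r.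
Qed.

Lemma inner_d0D (f g : S -> R) p : reg 1 (fun _ _ q => f q) -> reg 1 (fun _ _ q => g q) ->
  inner (d0 (fun p => f p + g p)) alpha p = inner (d0 f) alpha p + inner (d0 g) alpha p.
Proof.
move=> rf rg; rewrite /inner -inner_inDl; congr inner_in; apply/rowP => k.
rewrite [RHS]mxE (d0_comp (fun _ => f) k 1) (d0_comp (fun _ => g) k 1).
rewrite (d0_comp (fun _ p => f p + g p) k 1).
apply: dxD => //; exact: dom_chart_at.
Qed.

(** The partition of unity splits [f] into pieces carried by single squares. Only
the differentials of the pieces are compared in different charts, so the exterior
derivative of a covector field need not be shown chart independent. *)
Lemma stokes (f : S -> R) : reg 1 (fun _ _ q => f q) ->
  (\int[mu]_p (inner (d0 f) alpha p)%:E = 0)%E.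
Proof.
move=> rf; have [s Hs] := finite_bumps compactS.
pose g p := f p / \sum_(d <- s) sq_bump d p.
have rb d : reg 1 (fun _ _ p => sq_bump d p) by exact/reg_surface_bump/sq_in.
have rg : reg 1 (fun _ _ q => g q).
  apply: (regM _ (fun _ _ q => f q)) => //.
  apply: (regV _ (fun _ _ q => \sum_(d <- s) sq_bump d q)).
    by move=> *; rewrite gt_eqF.
  exact: (reg_sum 1 _ s (fun d _ _ p => sq_bump d p)).
have -> : f = fun p => \sum_(d <- s) (sq_bump d p * g p).
  apply/funext => p; rewrite -mulr_suml /g mulrCA divff ?mulr1// gt_eqF//.
have rbg d : reg 1 (fun _ _ p => sq_bump d p * g p) by exact: regM.
elim: (s) => [|d s' IH].
  rewrite (_ : (fun p => _) = cst 0); last by apply/funext => p; rewrite big_nil.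
  apply: integral0_eq => p _; rewrite /inner (_ : d0 _ _ _ = 0).
    by rewrite /inner_in !mul0mx mxE.
  by apply/rowP => k; rewrite !mxE; exact: derive_cst.
have rs : reg 1 (fun _ _ p => \sum_(d <- s') sq_bump d p * g p).
  exact: (reg_sum 1 _ s' (fun d _ _ p => sq_bump d p * g p)).
have -> : (fun p => \sum_(e <- d :: s') sq_bump e p * g p) =
    (fun p => sq_bump d p * g p + \sum_(e <- s') sq_bump e p * g p).
  by apply/funext => p; rewrite big_cons.
under eq_integral do rewrite inner_d0D// EFinD.
rewrite integralD//; last 2 first.
- exact: continuous_integrable_surface compactS mu_area _ (continuous_inner_d0 _ (rbg d)).
- exact: continuous_integrable_surface compactS mu_area _ (continuous_inner_d0 _ rs).
by rewrite stokes_square// IH adde0.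
Qed.

End Stokes.

(** * Differentiation of surface integrals in time *)
(** Stated for [s] and [t] in either order: estimates propagate from time 1 down to
time 0 as well as forward. *)
Lemma lipschitz_halfline {R : realType} (f df : R -> R) (K : R) :
  (forall t : R, 0 < t -> is_derive t 1 f (df t)) ->
  (forall t, 0 < t -> `|df t| <= K) ->
  forall s t, 0 < s -> 0 < t -> `|f t - f s| <= K * `|t - s|.
Proof.
move=> fd dK; have H (s t : R) : 0 < s -> s <= t -> `|f t - f s| <= K * `|t - s|.
  move=> s0 st.
  have pos r : r \in `[s, t]%R -> 0 < r.
    by rewrite in_itv/= => /andP[sr _]; exact: lt_le_trans sr.
  have [||r rst ->] := @MVT_segment _ f df s t st.
  - by move=> r rst; apply/fd/pos/subset_itv_oo_cc.
  - by apply: derivable_within_continuous => r /pos/fd[].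
  - by rewrite normrM ler_wpM2r// dK// pos.
move=> s t s0 t0; have [st|/ltW ts] := leP s t; first exact: H.
by rewrite distrC (distrC t); exact: H.
Qed.

Section TimeIntegral.
Context {R : realType} {S : riemannianSurface R}.
Variable mu : {measure set (borel S) -> \bar R}.
Hypotheses (compactS : compact [set: S]) (mu_area : area_measure mu).

Definition surface_integral (f : S -> R) : R := Rintegral mu [set: borel S] f.

Lemma reg_bounded (G : R -> S -> R) a b : reg 0 (fun t _ q => G t q) -> 0 < a ->
  exists M, forall t q, a <= t <= b -> `|G t q| <= M.
Proof.
move=> rG a0.
have [H|H] := pselect (([set` `[a, b]] `*` [set: S]) !=set0); last first.
  exists 0 => t q tab; exfalso; apply: H.
  by exists (t, q); split => //=; rewrite ?in_itv.
have cK : compact ([set` `[a, b]] `*` [set: S]).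
  by apply: compact_setX => //; exact: segment_compact.
have nc : {within [set` `[a, b]] `*` [set: S], continuous (fun z => `|G z.1 z.2|)}.
  apply: continuous_in_subspaceT => -[t q] /[!inE] -[/=]; rewrite in_itv/= => /andP[ta _] _.
  apply: (continuous_comp (reg_continuous G t q rG (lt_le_trans a0 ta))).
  exact: norm_continuous.
have [c _ cM] := compact_EVT_max H cK nc.
exists (`|G c.1 c.2|) => t q tab; apply: (cM (t, q)).
by rewrite inE; split => //=; rewrite ?in_itv.
Qed.

Lemma reg_freeze n (G : R -> S -> R) t : reg n (fun t _ q => G t q) -> 0 < t ->
  reg n (fun _ _ q => G t q).
Proof.
move=> rG t0; apply: (reg_static n (fun _ q => G t q)) => i.
exact: (reg_slice n (fun t _ q => G t q) t i t0 rG).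
Qed.

Lemma reg_integrable n (G : R -> S -> R) t : reg n (fun t _ q => G t q) -> 0 < t ->
  mu.-integrable [set: borel S] (EFin \o G t).
Proof.
move=> rG t0; apply: (continuous_integrable_surface mu compactS mu_area).
exact: reg_continuous_slice (reg0 _ _ rG) t0.
Qed.

(** On a compact time interval and the compact surface the time derivative is
bounded, and a constant is integrable because the area is finite. *)
Lemma is_derive_total (G : R -> S -> R) (t : R) : reg 1 (fun t _ q => G t q) -> 0 < t ->
  is_derive t 1 (fun t => surface_integral (G t)) (surface_integral (fun q => 'D_1 (G^~ q) t)).
Proof.
move=> rG t0.
have t20 : 0 < t / 2 by rewrite divr_gt0.
have [M HM] := reg_bounded (fun t q => 'D_1 (G^~ q) t) (t / 2) (2 * t)
  (reg_dt 0 _ rG) t20.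
have It : (`]t / 2, 2 * t[ : set R)%classic t.
  by rewrite /= in_itv/=; apply/andP; split; lra.
have pos x : (`]t / 2, 2 * t[ : set R)%classic x -> 0 < x.
  by rewrite /= in_itv/= => /andP[+ _]; exact: lt_trans.
have intf x : (`]t / 2, 2 * t[ : set R)%classic x ->
    mu.-integrable [set: borel S] (EFin \o G x).
  by move=> /pos; exact: (reg_integrable 1).
have derf x (y : borel S) : (`]t / 2, 2 * t[ : set R)%classic x -> [set: borel S] y ->
    derivable (G ^~ y) x 1.
  move=> /pos x0 _; exact: (derivable_dt 0 (fun t _ q => G t q) x (chart_at y)
      y rG x0 (dom_chart_at y)).
have intM : mu.-integrable [set: borel S] (EFin \o (fun=> `|M|)).
  by apply: (continuous_integrable_surface mu compactS mu_area); exact: cst_continuous.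
have ubM x (y : borel S) : (`]t / 2, 2 * t[ : set R)%classic x -> [set: borel S] y ->
    `|partial1of2 G x y| <= `|M|.
  rewrite /= in_itv/= => /andP[/ltW x1 /ltW x2] _; rewrite partial1of2E.
  by apply: le_trans (ler_norm M); apply: HM; rewrite x1 x2.
split.
  exact: (@derivable_under_integral R _ (borel S) mu G setT measurableT t _ _ It intf
    derf (fun=> `|M|) (fun=> normr_ge0 M) intM ubM).
rewrite -derive1E.
have := @differentiation_under_integral R _ (borel S) mu G setT measurableT t _ _ It intf
    derf (fun=> `|M|) (fun=> normr_ge0 M) intM ubM.
rewrite /surface_integral => ->; apply: eq_Rintegral => y _.
by rewrite partial1of2E.
Qed.

End TimeIntegral.

(** * Conservation of enstrophy and linear growth of the velocity *)
Section Growth.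
Context {R : realType} {S : riemannianSurface R}.
Variable mu : {measure set (borel S) -> \bar R}.
Hypotheses (compactS : compact [set: S]) (mu_area : area_measure mu).
Variables (gamma0 : form1 S).
Hypotheses (g0_field : covector_field gamma0) (g0_harmonic : harmonic_field gamma0).
Variables (psi omega : R -> S -> R) (gamma : R -> form1 S) (p : R -> S -> R).
Hypotheses (psi_smooth : smooth_evolution psi)
  (gamma_smooth : covector_evolution gamma)
  (gamma_harmonic : forall t : R, 0 <= t -> harmonic_field (gamma t))
  (p_smooth : smooth_evolution p)
  (lin : linearized_euler gamma0 psi omega gamma p).
Implicit Types (i : chart S) (q : S).

Let v := velocity psi gamma.

Let reg_psi n : reg n (fun t _ q => psi t q).
Proof. exact: (smooth_within_reg n (fun t _ q => psi t q)). Qed.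

Let reg_p n : reg n (fun t _ q => p t q).
Proof. exact: (smooth_within_reg n (fun t _ q => p t q)). Qed.

Let reg_gamma n : regF n gamma.
Proof. by move=> k; apply: smooth_within_reg => i; exact: gamma_smooth.2. Qed.

Let reg_g0 n : regF n (fun _ => gamma0).
Proof.
move=> k; apply: (reg_static n (fun i q => gamma0 i q 0 k)) => i.
exact/smooth_on_Ck/g0_field.2.
Qed.

Let reg_v n : regF n v.
Proof.
move=> k.
apply: (reg_eq n (fun t i q => star1 (d0 (psi t)) i q 0 k + gamma t i q 0 k)).
  by move=> t i q _ _; rewrite /v /velocity [RHS]mxE.
apply: regD; last exact: reg_gamma.
exact/(regF_star n (fun t => d0 (psi t)))/regF_d0/reg_psi.
Qed.

Let law_v t : 0 < t -> covector_law (v t).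
Proof.
move=> t0; apply: covector_lawD; last exact/gamma_smooth.1/ltW.
by apply: covector_law_star; exact: covector_law_d0.
Qed.

Let closed_star (a : form1 S) i q : harmonic_field a -> dom i q ->
  d1 (star1 a) i q = 0.
Proof.
move=> ha qi; have [_ /eqP] := ha i q qi.
rewrite /codiff /star2 oppr_eq0 mulf_eq0 invr_eq0 => /orP[/eqP//|].
by rewrite gt_eqF// area_form_gt0.
Qed.

Let d1D (a b : R -> form1 S) t i q : regF 1 a -> regF 1 b -> 0 < t -> dom i q ->
  d1 (fun i q => a t i q + b t i q) i q = d1 (a t) i q + d1 (b t) i q.
Proof.
move=> ra rb t0 qi; rewrite (d1E (fun t i q => a t i q + b t i q) t).
rewrite (dx_ext 0 _ (fun t i q => a t i q 0 1 + b t i q 0 1))//; last first.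
  by move=> *; rewrite [LHS]mxE.
rewrite (dx_ext 1 _ (fun t i q => a t i q 0 0 + b t i q 0 0))//; last first.
  by move=> *; rewrite [LHS]mxE.
rewrite (dxD 0 _ _ _ _ _ (ra 1) (rb 1))// (dxD 1 _ _ _ _ _ (ra 0) (rb 0))// !d1E.
ring.
Qed.

Let d1_ext (a b : form1 S) i q : dom i q ->
  (forall r, dom i r -> a i r = b i r) -> d1 a i q = d1 b i q.
Proof.
move=> qi ab; rewrite (d1E (fun=> a) 1) (d1E (fun=> b) 1).
by congr (_ - _); apply: dx_ext => // r ri; rewrite ab.
Qed.

(** [star v = - d psi + star gamma], because the star squares to [-1]; the first
term is closed by symmetry of second derivatives, the second as [gamma] is
harmonic. *)
Let coclosed_v t i q : 0 < t -> dom i q -> d1 (star1 (v t)) i q = 0.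
Proof.
move=> t0 qi.
pose a t i q := - d0 (psi t) i q.
rewrite (d1_ext _ (fun i q => a t i q + star1 (gamma t) i q))//; last first.
  move=> r ri; rewrite /a -(star1K (d0 (psi t)) ri) star1E /v /velocity mulmxDl.
  by rewrite -!star1E.
have rd := regF_d0 1 psi (reg_psi 2).
have ra : regF 1 a.
  move=> k; apply: (reg_eq 1 (fun t i q => - d0 (psi t) i q 0 k)).
    by move=> *; rewrite /a [RHS]mxE.
  exact/regN/rd.
rewrite (d1D _ _ _ _ _ ra (regF_star 1 _ (reg_gamma 1)))//.
rewrite closed_star ?addr0//; last exact/gamma_harmonic/ltW.
rewrite d1E.
have E k : (fun t i q => a t i q 0 k) = (fun t i q => - dx k (fun t _ q => psi t q) t i q).
  by do 3 apply/funext => ?; rewrite /a mxE d0_comp.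
rewrite !E !dxN//; [|exact: reg_dx|exact: reg_dx].
by rewrite (dx_dx 0 1)// opprK addNr.
Qed.

(** The vorticity is defined by [star d psi] alone, and adding the closed [gamma]
does not change it. *)
Let area_vorticity t i q : 0 < t -> dom i q ->
  area_form i q * omega t q = d1 (v t) i q.
Proof.
move=> t0 qi; have [_ <-] := lin t (ltW t0) i q qi.
have rs := regF_star 1 _ (regF_d0 1 psi (reg_psi 2)).
have -> : d1 (v t) i q = d1 (star1 (d0 (psi t))) i q + d1 (gamma t) i q.
  exact: (d1D (fun t => star1 (d0 (psi t))) gamma).
have [-> _] := gamma_harmonic t (ltW t0) i q qi.
by rewrite addr0 /codiff opprK /star2 mulrC divfK// gt_eqF// area_form_gt0.
Qed.

Let reg_omega n : reg n (fun t _ q => omega t q).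
Proof.
apply: (reg_eq n (fun t i q => (area_form i q)^-1 *
   (dx 0 (fun t i q => v t i q 0 1) t i q - dx 1 (fun t i q => v t i q 0 0) t i q))).
  move=> t i q t0 qi; rewrite -d1E -area_vorticity// mulKf// gt_eqF//.
  exact: area_form_gt0.
apply: regM.
  by apply: regV; [move=> *; rewrite gt_eqF// area_form_gt0|exact: reg_area].
by apply: regB; exact/reg_dx/reg_v.
Qed.

Let dt_v t i q k : 0 < t -> dom i q -> dt (fun t i q => v t i q 0 k) t i q =
  - (omega t q * star1 gamma0 i q 0 k) - dx k (fun t _ q => p t q) t i q.
Proof.
move=> t0 qi.
have H : star1 (d0 (dt0 psi t)) i q 0 k + dt1 gamma t i q 0 k
    + omega t q * star1 gamma0 i q 0 k + d0 (p t) i q 0 k = 0.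
  have addE (A B : 'rV[R]_2) : (A + B) 0 k = A 0 k + B 0 k by rewrite mxE.
  have scaleE (A : 'rV[R]_2) : (omega t q *: A) 0 k = omega t q * A 0 k by rewrite mxE.
  have [/(congr1 (fun M : 'rV_2 => M 0 k)) + _] := lin t (ltW t0) i q qi.
  by cbv beta; rewrite !addE scaleE [X in _ = X -> _]mxE.
rewrite d0_comp in H.
rewrite (dt_ext _ (fun t i q => (dx 0 (fun t _ q => psi t q) t i q * star_mx i q 0 k
    + dx 1 (fun t _ q => psi t q) t i q * star_mx i q 1 k) + gamma t i q 0 k))//; last first.
  by move=> s s0; rewrite /v /velocity [LHS]mxE star1_comp !d0_comp.
have r0 := regM 1 _ _ (reg_dx 1 0 _ (reg_psi 2)) (reg_star_mx 1 0 k).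
have r1 := regM 1 _ _ (reg_dx 1 1 _ (reg_psi 2)) (reg_star_mx 1 1 k).
rewrite (dtD _ _ _ _ _ (regD 1 _ _ r0 r1) (reg_gamma 1 k) t0 qi).
rewrite (dtD _ _ _ _ _ r0 r1 t0 qi).
rewrite (dtM _ _ _ _ _ (reg_dx 1 0 _ (reg_psi 2)) (reg_star_mx 1 0 k) t0 qi).
rewrite (dtM _ _ _ _ _ (reg_dx 1 1 _ (reg_psi 2)) (reg_star_mx 1 1 k) t0 qi).
rewrite (dt_static (fun i q => star_mx i q 0 k)) (dt_static (fun i q => star_mx i q 1 k)).
rewrite -!(dx_dt _ _ _ _ _ (reg_psi 2) t0 qi).
have E : star1 (d0 (dt0 psi t)) i q 0 k =
    dx 0 (dt (fun t _ q => psi t q)) t i q * star_mx i q 0 k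
    + dx 1 (dt (fun t _ q => psi t q)) t i q * star_mx i q 1 k.
  have Ed l : d0 (dt0 psi t) i q 0 l = dx l (dt (fun t _ q => psi t q)) t i q.
    rewrite (d0_comp (fun t => dt0 psi t)); apply: dx_ext => // r _.
    by rewrite /dt0 time_deriveE.
  by rewrite star1_comp !Ed.
have Eg : dt1 gamma t i q 0 k = dt (fun t i q => gamma t i q 0 k) t i q.
  by rewrite mxE time_deriveE.
move: H; rewrite E Eg => H.
have solve_dt (a b c d m0 m1 g w x : R) : a * m0 + b * m1 + g + w + x = 0 ->
    c * 0 + m0 * a + (d * 0 + m1 * b) + g = - w - x.
  move=> h; apply/eqP; rewrite -subr_eq0 -[X in _ == X]h; apply/eqP; ring.
exact: solve_dt H.
Qed.

(** The exterior derivative of the linearized equation: [dp] disappears by symmetry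
of second derivatives, and [star gamma0] is closed, so the vorticity is transported
by the base flow. *)
Let dt_omega t q : 0 < t ->
  'D_1 (omega^~ q) t = - inner (d0 (omega t)) gamma0 q.
Proof.
move=> t0; pose i := chart_at q; have qi : dom i q := dom_chart_at q.
have A0 : area_form i q != 0 by rewrite gt_eqF// area_form_gt0.
apply: (mulfI A0).
have lo : covector_law (d0 (omega t)) by exact/covector_law_d0.
rewrite mulrN (inner_chart lo g0_field.1 qi) [in RHS]mulrC -wedge_star//.
transitivity (dt (fun t i q => area_form i q * omega t q) t i q).
  rewrite (dtM _ _ _ _ _ (reg_area 1) (reg_omega 1) t0 qi).
  by rewrite (dt_static (fun i q => area_form i q)) mulr0 addr0.
rewrite (dt_ext _ (fun t i q => dx 0 (fun t i q => v t i q 0 1) t i q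
    + - dx 1 (fun t i q => v t i q 0 0) t i q))//; last first.
  by move=> s s0; rewrite area_vorticity// d1E.
have rd k l : reg 1 (dx k (fun t i q => v t i q 0 l)) by exact/reg_dx/reg_v.
rewrite (dtD _ _ _ _ _ (rd 0 1) (regN _ _ (rd 1 0)) t0 qi).
rewrite (_ : dt (fun t i q => - dx 1 (fun t i q => v t i q 0 0) t i q) t i q =
    - dt (dx 1 (fun t i q => v t i q 0 0)) t i q); last first.
  exact: deriveN (derivable_dt _ _ _ _ _ (rd 1 0) t0 qi).
rewrite -!(dx_dt _ _ _ _ _ (reg_v 2 _) t0 qi).
have rs := regF_star 1 _ (reg_g0 1).
have rp k : reg 1 (dx k (fun t _ q => p t q)) by exact/reg_dx/reg_p.
have E k l : dx k (dt (fun t i q => v t i q 0 l)) t i q =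
  - (omega t q * dx k (fun _ i q => star1 gamma0 i q 0 l) t i q +
     star1 gamma0 i q 0 l * dx k (fun t _ q => omega t q) t i q)
  - dx k (dx l (fun t _ q => p t q)) t i q.
  rewrite (dx_ext k _ (fun t i q => - (omega t q * star1 gamma0 i q 0 l)
     + - dx l (fun t _ q => p t q) t i q))//; last by move=> *; exact: dt_v.
  have rw := regM 1 _ _ (reg_omega 1) (rs l).
  rewrite (dxD k _ _ _ _ _ (regN _ _ rw) (regN _ _ (rp l)) t0 qi).
  rewrite (dxN k _ _ _ _ rw t0 qi) (dxN k _ _ _ _ (rp l) t0 qi).
  by rewrite (dxM k _ _ _ _ _ (reg_omega 1) (rs l) t0 qi).
rewrite !E (dx_dx 0 1 _ _ _ _ (reg_p 2) t0 qi).
have := closed_star gamma0 i q g0_harmonic qi; rewrite (d1E (fun=> star1 gamma0) t) => C.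
rewrite /wedge !d0_comp.
move: C; set a := dx 0 (fun _ i q => star1 gamma0 i q 0 1) t i q.
set b := dx 1 (fun _ i q => star1 gamma0 i q 0 0) t i q.
move=> /eqP; rewrite subr_eq0 => /eqP ->; ring.
Qed.

Let enstrophy t := surface_integral mu (fun q => omega t q * omega t q).

Let energy t := surface_integral mu (inner (v t) (v t)).

(** The derivative of [omega ^ 2] is [- (d (omega ^ 2), gamma0)], and [gamma0] is
coclosed. *)
Let is_derive_enstrophy (t : R) : 0 < t -> is_derive t 1 enstrophy 0.
Proof.
move=> t0.
have rw n : reg n (fun t _ q => omega t q * omega t q) by exact: regM.
have := is_derive_total mu compactS mu_area (fun t q => omega t q * omega t q) t (rw 1) t0.
move=> /is_derive_eq; apply.
have E q : 'D_1 (fun s => omega s q * omega s q) t =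
    - inner (d0 (fun q => omega t q * omega t q)) gamma0 q.
  pose i := chart_at q; have qi : dom i q := dom_chart_at q.
  rewrite [LHS](dtM _ _ _ _ _ (reg_omega 1) (reg_omega 1) t0 qi).
  rewrite /dt dt_omega// /inner.
  rewrite (_ : d0 (fun q => omega t q * omega t q) i q =
     (2 * omega t q) *: d0 (omega t) i q).
    by rewrite inner_inZl; ring.
  apply/rowP => k; rewrite [RHS]mxE (d0_comp (fun t q => omega t q * omega t q)).
  rewrite (dxM k _ _ _ _ _ (reg_omega 1) (reg_omega 1) t0 qi) d0_comp; ring.
rewrite (_ : surface_integral mu _ = surface_integral mu (fun q =>
    (-1) * inner (d0 (fun q => omega t q * omega t q)) gamma0 q)); last first.
  by apply: eq_Rintegral => q _; rewrite E mulN1r.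
have rwt : reg 1 (fun _ _ q => omega t q * omega t q) by exact: (reg_freeze 1
    (fun t q => omega t q * omega t q) t (rw 1) t0).
rewrite /surface_integral RintegralZl//; last first.
  apply: (continuous_integrable_surface mu compactS mu_area).
  exact: (continuous_inner_d0 gamma0 (reg_g0 1) g0_field.1 _ rwt).
rewrite /Rintegral (stokes mu compactS mu_area gamma0 (reg_g0 1) g0_field.1)//.
  by rewrite /= mulr0.
by move=> i q; exact: closed_star.
Qed.

Let enstrophy_cst t : 0 < t -> enstrophy t = enstrophy 1.
Proof.
move=> t0; apply/eqP; rewrite -subr_eq0 -normr_le0.
have d0 (s : R) : 0 < s -> `|0 : R| <= 0 by rewrite normr0.
have := lipschitz_halfline enstrophy (fun=> 0) 0 is_derive_enstrophy d0 1 t ltr01 t0.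
by rewrite mul0r.
Qed.

(** The time derivative of the velocity, according to the linearized equation. *)
Let acc t i q : 'rV[R]_2 := - (omega t q *: star1 gamma0 i q) - d0 (p t) i q.

Let dt_inner_v (t : R) q : 0 < t -> 'D_1 (fun s => inner (v s) (v s) q) t =
  - (2 * omega t q * inner (star1 gamma0) (v t) q) - 2 * inner (d0 (p t)) (v t) q.
Proof.
move=> t0; pose i := chart_at q; have qi : dom i q := dom_chart_at q.
have accE : inner_in i q (acc t i q) (v t i q) =
    - (omega t q * inner (star1 gamma0) (v t) q) - inner (d0 (p t)) (v t) q.
  by rewrite /acc inner_inDl !inner_inNl inner_inZl.
have rowE c (A B : 'rV[R]_2) k : (- (c *: A) - B) 0 k = - (c * A 0 k) - B 0 k.
  by rewrite !mxE.
have vd k : is_derive t 1 (fun s => v s i q 0 k) (acc t i q 0 k).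
  rewrite /acc rowE d0_comp -dt_v//; apply: derivableP.
  exact: (derivable_dt 0 (fun t i q => v t i q 0 k) t i q (reg_v 1 k) t0 qi).
have c10 : invmx (metric i q) 1 0 = invmx (metric i q) 0 1.
  by rewrite -[in LHS](Defs.metric_sym qi) -trmx_inv mxE.
have inner2 (a b : 'rV[R]_2) : inner_in i q a b =
   (a 0 0 * invmx (metric i q) 0 0 + a 0 1 * invmx (metric i q) 0 1) * b 0 0 +
   (a 0 0 * invmx (metric i q) 0 1 + a 0 1 * invmx (metric i q) 1 1) * b 0 1.
  by rewrite inner_in_comp !sum_ord2 c10.
transitivity (2 * inner_in i q (acc t i q) (v t i q)); last by rewrite accE; ring.
pose f k s := v s i q 0 k.
have vd0 : is_derive t 1 (f 0) (acc t i q 0 0) := vd 0.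
have vd1 : is_derive t 1 (f 1) (acc t i q 0 1) := vd 1.
rewrite (_ : (fun s => inner (v s) (v s) q) =
  (f 0 * cst (invmx (metric i q) 0 0) + f 1 * cst (invmx (metric i q) 0 1)) * f 0 +
  (f 0 * cst (invmx (metric i q) 0 1) + f 1 * cst (invmx (metric i q) 1 1)) * f 1).
  rewrite derive_val inner2.
  have solve (f0 f1 a0 a1 c00 c01 c11 : R) :
      (f0 * c00 + f1 * c01) * a0 + f0 * (f0 * 0 + c00 * a0 + (f1 * 0 + c01 * a1))
      + ((f0 * c01 + f1 * c11) * a1 + f1 * (f0 * 0 + c01 * a0 + (f1 * 0 + c11 * a1)))
      = 2 * ((a0 * c00 + a1 * c01) * f0 + (a0 * c01 + a1 * c11) * f1) by ring.
  exact: solve.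
by apply/funext => s; rewrite /inner inner2.
Qed.

Let reg_energy n : reg n (fun t _ q => inner (v t) (v t) q).
Proof. exact: (reg_inner n v v). Qed.

Let star_g0_bounded : exists2 c, 0 <= c &
  forall q, inner (star1 gamma0) (star1 gamma0) q <= c.
Proof.
have rs := regF_star 0 _ (reg_g0 0).
have ls := covector_law_star gamma0 g0_field.1.
have sc : continuous (inner (star1 gamma0) (star1 gamma0)).
  apply: (reg_continuous_slice (fun _ => inner (star1 gamma0) (star1 gamma0)) 1) => //.
  exact: (reg_inner 0 (fun _ => star1 gamma0) (fun _ => star1 gamma0)).
have [M HM] := continuous_bounded_surface compactS _ sc.
exists `|M| => // q; apply: le_trans (ler_norm _) (le_trans (HM q) (ler_norm M)).
Qed.

Let energy_ge0 t : 0 <= energy t.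
Proof.
apply: Rintegral_ge0 => q _; apply: inner_in_ge0; exact: dom_chart_at.
Qed.

(** The pressure does no work: its contribution is [(dp, v)], and [v] is
coclosed. *)
Let is_derive_energy (t : R) : 0 < t -> is_derive t 1 energy
  (surface_integral mu (fun q => - (2 * omega t q * inner (star1 gamma0) (v t) q))).
Proof.
move=> t0.
have := is_derive_total mu compactS mu_area (fun t => inner (v t) (v t)) t (reg_energy 1) t0.
move=> /is_derive_eq; apply.
have rp1 : reg 1 (fun _ _ q => p t q) by exact: (reg_freeze 1 p t (reg_p 1) t0).
have rv1 : regF 1 (fun _ => v t).
  move=> k; apply: (reg_static 1 (fun i q => v t i q 0 k)) => i.
  exact: (reg_slice 1 (fun t i q => v t i q 0 k) t i t0 (reg_v 1 k)).
have ip : mu.-integrable [set: borel S] (EFin \o inner (d0 (p t)) (v t)).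
  apply: (continuous_integrable_surface mu compactS mu_area).
  exact: (continuous_inner_d0 (v t) rv1 (law_v t t0) _ rp1).
have iw : mu.-integrable [set: borel S]
    (EFin \o (fun q => - (2 * omega t q * inner (star1 gamma0) (v t) q))).
  apply: (reg_integrable mu compactS mu_area 0
    (fun t q => - (2 * omega t q * inner (star1 gamma0) (v t) q)) t) => //.
  apply: regN; apply: regM; first by apply: regM; [exact: reg_cst|exact: reg_omega].
  apply: (reg_inner 0 (fun _ => star1 gamma0) v) => //.
  - exact: regF_star.
  - by move=> *; apply: covector_law_star; exact: g0_field.1.
rewrite (_ : surface_integral mu (fun q => 'D_1 (fun s => inner (v s) (v s) q) t) =
  surface_integral mu (fun q => - (2 * omega t q * inner (star1 gamma0) (v t) q)
    - 2 * inner (d0 (p t)) (v t) q)); last first.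
  by apply: eq_Rintegral => q _; exact: dt_inner_v.
rewrite /surface_integral RintegralB//; last first.
  rewrite (_ : _ \o _ = (fun q => 2%:E * (inner (d0 (p t)) (v t) q)%:E)%E)//.
  exact: integrableZl.
rewrite [X in _ - X]RintegralZl//.
rewrite [X in _ - 2 * X]/Rintegral (stokes mu compactS mu_area (v t) rv1 (law_v t t0))//.
  by rewrite /= mulr0 subr0.
by move=> i q; exact: coclosed_v.
Qed.

(** Adding 1 to the energy before taking the square root keeps it differentiable
where the velocity vanishes, and makes Young's inequality with parameter
[N t = sqrt (energy t + 1)] bound the derivative of [N] by a constant, since the
enstrophy is constant. *)
Lemma L2norm_velocity_linear : exists A B : R, [/\ 0 <= A, 0 <= B &
    forall t : R, 0 <= t -> L2norm mu (velocity psi gamma t) <= A + B * t].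
Proof.
have [c c0 Hc] := star_g0_bounded.
pose K := (c * enstrophy 1 + 1) / 2.
have W0 : 0 <= enstrophy 1 by apply: Rintegral_ge0 => q _; exact: sqr_ge0.
have K0 : 0 <= K by rewrite /K divr_ge0// addr_ge0// mulr_ge0.
pose N t := Num.sqrt (energy t + 1).
have E1 t : 0 < energy t + 1 by rewrite ltr_wpDl.
have Nd (t : R) : 0 < t -> is_derive t 1 N ((2 * N t)^-1 *
    surface_integral mu (fun q => - (2 * omega t q * inner (star1 gamma0) (v t) q))).
  move=> t0; have ed := is_derive_energy t t0.
  have ed1 : is_derive t 1 (energy + cst 1)
     (surface_integral mu (fun q => - (2 * omega t q * inner (star1 gamma0) (v t) q))).
    by apply: is_derive_eq; rewrite addr0.
  have sd : is_derive ((energy + cst 1) t) 1 Num.sqrt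
    (2 * Num.sqrt ((energy + cst 1) t))^-1 by apply: is_derive1_sqrt; exact: E1.
  have := is_derive1_comp sd ed1; exact.
have rw : forall t, 0 < t -> `|(2 * N t)^-1 *
    surface_integral mu (fun q => - (2 * omega t q * inner (star1 gamma0) (v t) q))| <= K.
  move=> t t0; have N0 : 0 < N t by rewrite sqrtr_gt0.
  have N2 : N t ^+ 2 = energy t + 1 by rewrite sqr_sqrtr// ltW.
  have bound : `|surface_integral mu (fun q => - (2 * omega t q * inner (star1 gamma0) (v t) q))|
      <= N t * (c * enstrophy t) + (N t)^-1 * energy t.
    have iw := reg_integrable mu compactS mu_area 0 (fun t q => omega t q * omega t q) t
      (regM _ _ _ (reg_omega 0) (reg_omega 0)) t0.
    have ie := reg_integrable mu compactS mu_area 0 (fun t => inner (v t) (v t)) t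
      (reg_energy 0) t0.
    have reg_i : reg 0 (fun t _ q => 2 * omega t q * inner (star1 gamma0) (v t) q).
      apply: regM; first by apply: regM; [exact: reg_cst|exact: reg_omega].
      apply: (reg_inner 0 (fun _ => star1 gamma0) v) => //.
      - exact: regF_star.
      - by move=> *; apply: covector_law_star; exact: g0_field.1.
    have ii := reg_integrable mu compactS mu_area 0
      (fun t q => - (2 * omega t q * inner (star1 gamma0) (v t) q)) t (regN _ _ reg_i) t0.
    have iZ (k : R) (f : S -> R) : mu.-integrable [set: borel S] (EFin \o f) ->
        mu.-integrable [set: borel S] (EFin \o (fun q => k * f q)).
      move=> fi; rewrite (_ : _ \o _ = (fun q => k%:E * (f q)%:E)%E)//.
      exact: integrableZl.
    have iD (f g : S -> R) : mu.-integrable [set: borel S] (EFin \o f) ->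
        mu.-integrable [set: borel S] (EFin \o g) ->
        mu.-integrable [set: borel S] (EFin \o (fun q => f q + g q)).
      move=> fi gi; rewrite (_ : _ \o _ = (fun q => (f q)%:E + (g q)%:E)%E)//.
      exact: integrableD.
    have iab : mu.-integrable [set: borel S] (EFin \o (fun q =>
        N t * c * (omega t q * omega t q) + (N t)^-1 * inner (v t) (v t) q)).
      apply: (iD (fun q => N t * c * (omega t q * omega t q))
        (fun q => (N t)^-1 * inner (v t) (v t) q)); first exact: iZ iw.
      exact: iZ ie.
    apply: le_trans (le_normr_Rintegral measurableT ii) _.
    rewrite mulrA /enstrophy /energy /surface_integral.
    rewrite -(RintegralZl _ measurableT iw) -(RintegralZl _ measurableT ie).
    rewrite -RintegralD//; [|exact: iZ|exact: iZ].
    apply: le_Rintegral => //; first exact: integrable_norm ii.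
    move=> q _; rewrite normrN.
    have qi : dom (chart_at q) q := dom_chart_at q.
    have := inner_in_young (chart_at q) q (omega t q *: star1 gamma0 (chart_at q) q)
      (v t (chart_at q) q) (N t) qi N0.
    rewrite inner_inZl inner_inZl (inner_inC _ _ _ (_ *: _) qi) inner_inZl.
    move=> H.
    apply: (@le_trans _ _ (N t * (omega t q * (omega t q * inner (star1 gamma0) (star1 gamma0) q))
      + (N t)^-1 * inner (v t) (v t) q)).
      by rewrite -mulrA normrM ger0_norm.
    rewrite lerD2r -!mulrA ler_pM2l// mulrA mulrC.
    by rewrite ler_wpM2r// -expr2 sqr_ge0.
  have -> : K = (2 * N t)^-1 * (N t * (c * enstrophy 1 + 1)).
    by rewrite /K; field; rewrite gt_eqF.
  have N20 : 0 < (2 * N t)^-1 by rewrite invr_gt0 mulr_gt0.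
  rewrite normrM (gtr0_norm N20) ler_pM2l//.
  apply: le_trans bound _; rewrite enstrophy_cst// mulrDr lerD2l.
  by rewrite mulr1 ler_pdivrMl// -expr2 N2 lerDl.
have lip t : 0 < t -> N t <= N 1 + K * `|t - 1|.
  move=> t0; have := lipschitz_halfline N _ K Nd rw 1 t ltr01 t0.
  by rewrite -lerBlDl; apply: le_trans; exact: ler_norm.
(* Time 0 is accounted for separately, by the first summand of A. *)
exists (L2norm mu (velocity psi gamma 0) + (N 1 + K)), K; split => //.
  by rewrite !addr_ge0// sqrtr_ge0.
move=> t; rewrite le_eqVlt => /predU1P[<-|t0].
  by rewrite mulr0 addr0 lerDl addr_ge0// sqrtr_ge0.
have LN : L2norm mu (velocity psi gamma t) <= N t.
  by apply: ler_wsqrtr; change (energy t <= energy t + 1); rewrite lerDl.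
apply: le_trans LN _; apply: le_trans (lip t t0) _.
have tt : `|t - 1| <= 1 + t.
  by rewrite ler_norml; apply/andP; split; lra.
have Kt : K * `|t - 1| <= K + K * t.
  by rewrite -{2}[K]mulr1 -mulrDr ler_wpM2l.
have L0 : 0 <= L2norm mu (velocity psi gamma 0) by exact: sqrtr_ge0.
by rewrite -!addrA (le_trans (_ : _ <= N 1 + (K + K * t)))// ?lerD2l// lerDr.
Qed.

End Growth.

Theorem theorem1 (R : realType) (S : riemannianSurface R)
    (compactS : compact [set: S]) (connectedS : connected [set: S])
    (mu : {measure set (borel S) -> \bar R}) (mu_area : area_measure mu)
    (gamma0 : form1 S) (p0 : R -> S -> R) (F : R -> form1 S)
    (base : harmonic_euler_flow gamma0 p0 F)
    (psi omega : R -> S -> R) (gamma : R -> form1 S) (p : R -> S -> R)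
    (psi_smooth : smooth_evolution psi)
    (gamma_smooth : covector_evolution gamma)
    (gamma_harmonic : forall t : R, 0 <= t -> harmonic_field (gamma t))
    (p_smooth : smooth_evolution p)
    (lin : linearized_euler gamma0 psi omega gamma p) :
  exists A B : R, [/\ 0 <= A, 0 <= B &
    forall t : R, 0 <= t -> L2norm mu (velocity psi gamma t) <= A + B * t].
Proof.
have [gamma0_field gamma0_harmonic _ _ _] := base.
exact: (L2norm_velocity_linear mu compactS mu_area gamma0 gamma0_field
  gamma0_harmonic psi omega gamma p psi_smooth gamma_smooth gamma_harmonic
  p_smooth lin).
Qed.
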